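(* Let $\Gamma=\langle a,b\mid (ba)^3,(ab^{-1}a)^3,[ba,ab^{-1}a]\rangle$ and let $\Gamma^\circ$ be the kernel of the homomorphism $\mu\colon\Gamma\to C_3=\langle\sigma\mid\sigma^3=1\rangle$ with $\mu(a)=\sigma$, $\mu(b)=\sigma^2$. Let $\mathbb F_3(t)$ be the rational function field over $\mathbb F_3$ and put $u:=t^3$. Then the assignment $$\rho(a)=\begin{pmatrix}0&0&1/t\\ 2/t&0&0\\ 2t^2&2t^2&0\end{pmatrix},\qquad \rho(b)=\begin{pmatrix}0&2t&0\\ 0&0&2/t^2\\ t&0&t\end{pmatrix}$$ extends to a homomorphism $\rho\colon\Gamma\to\mathrm{SL}_3(\mathbb F_3(t))$, and the following hold. (1) $\rho(\Gamma^\circ)\le\mathrm{SL}_3(\mathbb F_3[u])$. (2) (a) $\rho(\Gamma^\circ)$ contains the principal congruence subgroup $\mathrm{SL}_3(\mathbb F_3[u],(u^2))$; in particular, $\rho(\Gamma^\circ)$ has finite index in $\mathrm{SL}_3(\mathbb F_3[u])$. (b) The quotient $$\bigl(\rho(\Gamma^\circ)\cap\mathrm{SL}_3(\mathbb F_3[u],(u))\bigr)\big/\bigl(\rho(\Gamma^\circ)\cap\mathrm{SL}_3(\mathbb F_3[u],(u^2))\bigr)$$ is isomorphic to a $7$-dimensional subspace of $\mathfrak{sl}_3(\mathbb F_3)$. (c) The quotient $\rho(\Gamma^\circ)/\bigl(\rho(\Gamma^\circ)\cap\mathrm{SL}_3(\mathbb F_3[u],(u))\bigr)$ is isomorphic to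 $\mathrm U_+(\mathbb F_3)$, the subgroup of upper triangular unipotent matrices in $\mathrm{SL}_3(\mathbb F_3)$.
   Context: Notation: $[x,y]=xyx^{-1}y^{-1}$. $\mathbb F_3(u)$ is viewed as a subfield of $\mathbb F_3(t)$ via $u\mapsto t^3$, so that $\mathrm{SL}_3(\mathbb F_3[u])\subseteq\mathrm{SL}_3(\mathbb F_3(t))$. For an ideal $I$ of $\mathbb F_3[u]$, $\mathrm{SL}_3(\mathbb F_3[u],I)$ is the principal congruence subgroup, i.e. the kernel of $\mathrm{SL}_3(\mathbb F_3[u])\to\mathrm{SL}_3(\mathbb F_3[u]/I)$. $\mathfrak{sl}_3(\mathbb F_3)$ is the space of trace-zero $3\times 3$ matrices over $\mathbb F_3$, regarded as an additive group. *)

(* Defs.v *)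
From HB Require Import structures.
From mathcomp Require Import all_boot all_order all_algebra generic_quotient qpoly.
From mathcomp Require Import boolp classical_sets cardinality.

Set Implicit Arguments.
Unset Strict Implicit.
Unset Printing Implicit Defensive.

Import GRing.Theory.

Section Subgroups.
Local Open Scope group_scope.

Section Predicates.
Variables (G H : groupType) (f : UMagmaMorphism.type G H).

Definition kerg : {pred G} := [pred x | f x == 1].

Fact kerg_mul : mulg_closed kerg.
Proof. by move=> x y; rewrite !inE gmulfM => /eqP-> /eqP->; rewrite mulg1. Qed.
Fact kerg_one : 1 \in kerg.
Proof. by rewrite inE gmulf1. Qed.
Fact kerg_inv : invg_closed kerg.
Proof. by move=> x; rewrite !inE gmulfV => /eqP->; rewrite invg1. Qed.

HB.instance Definition _ := isMulClosed.Build G kerg kerg_mul.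
HB.instance Definition _ := isMul1Closed.Build G kerg kerg_one.
HB.instance Definition _ := isInvClosed.Build G kerg kerg_inv.

Definition imageg (S : groupClosed G) : {pred H} :=
  [pred y | `[< exists2 x, x \in S & f x = y >]].

Fact imageg_mul S : mulg_closed (imageg S).
Proof.
move=> _ _ /asboolP[x Sx <-] /asboolP[y Sy <-]; apply/asboolP.
by exists (x * y); rewrite ?gmulfM ?gpredM.
Qed.
Fact imageg_one S : 1 \in imageg S.
Proof. by apply/asboolP; exists 1; rewrite ?gmulf1 ?gpred1. Qed.
Fact imageg_inv S : invg_closed (imageg S).
Proof.
move=> _ /asboolP[x Sx <-]; apply/asboolP.
by exists x^-1; rewrite ?gmulfV ?gpredVr.
Qed.

HB.instance Definition _ S := isMulClosed.Build H (imageg S) (@imageg_mul S).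
HB.instance Definition _ S := isMul1Closed.Build H (imageg S) (imageg_one S).
HB.instance Definition _ S := isInvClosed.Build H (imageg S) (@imageg_inv S).

Definition preimg (T : groupClosed H) : {pred G} := [pred x | f x \in T].

Fact preimg_mul T : mulg_closed (preimg T).
Proof. by move=> x y; rewrite !inE gmulfM; apply: gpredM. Qed.
Fact preimg_one T : 1 \in preimg T.
Proof. by rewrite inE gmulf1 gpred1. Qed.
Fact preimg_inv T : invg_closed (preimg T).
Proof. by move=> x; rewrite !inE gmulfV; apply: gpredVr. Qed.

HB.instance Definition _ T := isMulClosed.Build G (preimg T) (@preimg_mul T).
HB.instance Definition _ T := isMul1Closed.Build G (preimg T) (preimg_one T).
HB.instance Definition _ T := isInvClosed.Build G (preimg T) (@preimg_inv T).

Definition capg (S T : groupClosed G) : {pred G} :=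
  [pred x | (x \in S) && (x \in T)].

Fact capg_mul S T : mulg_closed (capg S T).
Proof. by move=> x y /andP[Sx Tx] /andP[Sy Ty]; rewrite inE !gpredM. Qed.
Fact capg_one S T : 1 \in capg S T.
Proof. by rewrite inE !gpred1. Qed.
Fact capg_inv S T : invg_closed (capg S T).
Proof. by move=> x /andP[Sx Tx]; rewrite inE !gpredVr. Qed.

HB.instance Definition _ S T := isMulClosed.Build G (capg S T) (@capg_mul S T).
HB.instance Definition _ S T := isMul1Closed.Build G (capg S T) (capg_one S T).
HB.instance Definition _ S T := isInvClosed.Build G (capg S T) (@capg_inv S T).

End Predicates.

Section SubgroupType.
Variables (G : groupType) (S : groupClosed G).

Record subgroup := Subgroup { sgval :> G; _ : sgval \in S }.

HB.instance Definition _ := [isSub for sgval].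
HB.instance Definition _ := [Choice of subgroup by <:].

Fact subgroup_closed : group_closed (S : {pred G}).
Proof. by split; [exact: gpred1 | move=> x y Sx Sy; rewrite gpredM ?gpredVr]. Qed.

HB.instance Definition _ :=
  SubChoice_isSubGroup.Build G _ subgroup subgroup_closed.

Lemma sgvalM : {morph sgval : x y / x * y}. Proof. by []. Qed.
Lemma sgvalV : {morph sgval : x / x^-1}. Proof. by []. Qed.

End SubgroupType.

Definition normal_in (G : groupType) (K H : groupClosed G) : Prop :=
  {subset K <= H} /\ (forall x y, x \in H -> y \in K -> x * y * x^-1 \in K).

Section Quotient.
Variables (G : groupType) (H K : groupClosed G).

Definition cosetrel (x y : subgroup H) : bool :=
  (sgval x)^-1 * sgval y \in K.

Fact cosetrel_refl : reflexive cosetrel.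
Proof. by move=> x; rewrite /cosetrel mulVg gpred1. Qed.
Fact cosetrel_sym : symmetric cosetrel.
Proof.
move=> x y; rewrite /cosetrel; apply/idP/idP => /gpredVr;
  by rewrite invgM invgK.
Qed.
Fact cosetrel_trans : transitive cosetrel.
Proof.
move=> y x z; rewrite /cosetrel => xy yz.
by have := gpredM _ _ xy yz; rewrite mulgA mulgK.
Qed.

Canonical cosetrel_equiv :=
  EquivRel cosetrel cosetrel_refl cosetrel_sym cosetrel_trans.

Local Open Scope quotient_scope.

(* The normality proof plays no role in the carrier H / K; it is what makes
   the coset product below a group law. *)
Definition quotg of normal_in K H := {eq_quot cosetrel}.

Variable nKH : normal_in K H.
Local Notation Q := (quotg nKH).

HB.instance Definition _ : EqQuotient _ cosetrel Q := EqQuotient.on Q.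
HB.instance Definition _ := Choice.on Q.

Definition quotg_one : Q := \pi_Q 1.
Definition quotg_mul (x y : Q) : Q := \pi_Q (repr x * repr y).
Definition quotg_inv (x : Q) : Q := \pi_Q (repr x)^-1.

Lemma quotg_eq (x y : subgroup H) : (\pi_Q x == \pi_Q y) = cosetrel x y.
Proof. exact: (@eqmodE _ cosetrel_equiv). Qed.

Lemma quotg_repr (x : subgroup H) : cosetrel (repr (\pi_Q x)) x.
Proof. by rewrite -quotg_eq reprK. Qed.

Lemma quotg_piM (x y : subgroup H) :
  quotg_mul (\pi_Q x) (\pi_Q y) = \pi_Q (x * y).
Proof.
apply/eqP; rewrite quotg_eq /cosetrel.
have := quotg_repr x; have := quotg_repr y.
move: (repr _) (repr _) => y' x'; rewrite /cosetrel => Ky Kx.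
rewrite !sgvalM invgM.
have /(_ (sgval y)^-1) := nKH.2 _ _ _ Kx; rewrite gpredVr ?(valP y) // invgK.
move=> /(_ isT) /(gpredM _ _ Ky).
by rewrite !mulgA mulgK.
Qed.

Lemma quotg_piV (x : subgroup H) : quotg_inv (\pi_Q x) = \pi_Q x^-1.
Proof.
apply/eqP; rewrite quotg_eq /cosetrel.
have := quotg_repr x; move: (repr _) => x'; rewrite /cosetrel => /gpredVr Kx.
have := nKH.2 _ _ (valP x) Kx.
by rewrite !sgvalV !invgM !invgK !mulgA mulgV mul1g.
Qed.

Fact quotg_mulA : associative quotg_mul.
Proof.
move=> x y z; elim/quotW: x => x; elim/quotW: y => y; elim/quotW: z => z.
by rewrite (quotg_piM y z) (quotg_piM x) (quotg_piM x y) (quotg_piM _ z) mulgA.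
Qed.
Fact quotg_mul1g : left_id quotg_one quotg_mul.
Proof. by move=> x; elim/quotW: x => x; rewrite quotg_piM mul1g. Qed.
Fact quotg_mulg1 : right_id quotg_one quotg_mul.
Proof. by move=> x; elim/quotW: x => x; rewrite quotg_piM mulg1. Qed.
Fact quotg_mulVg : left_inverse quotg_one quotg_inv quotg_mul.
Proof. by move=> x; elim/quotW: x => x; rewrite quotg_piV quotg_piM mulVg. Qed.
Fact quotg_mulgV : right_inverse quotg_one quotg_inv quotg_mul.
Proof. by move=> x; elim/quotW: x => x; rewrite quotg_piV quotg_piM mulgV. Qed.

HB.instance Definition _ := isGroup.Build Q
  quotg_mulA quotg_mul1g quotg_mulg1 quotg_mulVg quotg_mulgV.

End Quotient.

Lemma capg_kerg_normal (G H : groupType) (f : UMagmaMorphism.type G H)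
    (S T : groupClosed G) :
  {subset kerg f <= T} -> normal_in (capg S (kerg f)) (capg S T).
Proof.
move=> fT; split=> [x /andP[Sx fx]|x y /andP[Sx _] /andP[Sy fy]].
  by rewrite inE Sx fT.
apply/andP; split; first by rewrite !gpredM ?gpredVr.
by move: fy; rewrite !inE => /eqP fy; rewrite !gmulfM gmulfV fy mulg1 mulgV.
Qed.

Lemma capg_kerg_normal_l (G H : groupType) (f : UMagmaMorphism.type G H)
    (S : groupClosed G) :
  normal_in (capg S (kerg f)) S.
Proof.
split=> [x /andP[]//|x y Sx Ky].
case/andP: Ky => Sy fy; apply/andP; split; first by rewrite !gpredM ?gpredVr.
by move: fy; rewrite !inE => /eqP fy; rewrite !gmulfM gmulfV fy mulg1 mulgV.
Qed.

Definition isog (G H : groupType) : Prop :=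
  exists f : {multiplicative G -> H}, bijective f.

Definition finite_index (G : groupType) (H : groupClosed G) : Prop :=
  finite_set (range (fun g : G => [set x : G | g^-1 * x \in H]%classic)).

End Subgroups.

Section Presentation.
Variables (X : choiceType).

(* The letter (x, false) stands for x, and (x, true) for its inverse. *)
Definition word := seq (X * bool).

Definition winv (w : word) : word := rev [seq (l.1, ~~ l.2) | l <- w].
Definition wexp (w : word) (n : nat) : word := flatten (nseq n w).
(* [x, y] = x y x^-1 y^-1, unlike the library's [~ x, y] = x^-1 y^-1 x y. *)
Definition wcomm (v w : word) : word := v ++ w ++ winv v ++ winv w.

Variable rels : seq word.

Inductive pres_eq : word -> word -> Prop :=
| pres_refl w : pres_eq w w
| pres_sym v w : pres_eq v w -> pres_eq w v
| pres_trans v w z : pres_eq v w -> pres_eq w z -> pres_eq v z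
| pres_cat v v' w w' :
    pres_eq v v' -> pres_eq w w' -> pres_eq (v ++ w) (v' ++ w')
| pres_cancel x e : pres_eq [:: (x, e); (x, ~~ e)] [::]
| pres_rel r : r \in rels -> pres_eq r [::].

Definition pres_eqb (v w : word) : bool := `[< pres_eq v w >].

Fact pres_eqb_refl : reflexive pres_eqb.
Proof. by move=> w; apply/asboolP/pres_refl. Qed.
Fact pres_eqb_sym : symmetric pres_eqb.
Proof. by move=> v w; apply/asboolP/asboolP; apply: pres_sym. Qed.
Fact pres_eqb_trans : transitive pres_eqb.
Proof.
by move=> w v z /asboolP vw /asboolP wz; apply/asboolP/(pres_trans vw wz).
Qed.

Canonical pres_equiv :=
  EquivRel pres_eqb pres_eqb_refl pres_eqb_sym pres_eqb_trans.

Local Open Scope quotient_scope.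

Definition presented := {eq_quot pres_eqb}.

HB.instance Definition _ : EqQuotient _ pres_eqb presented :=
  EqQuotient.on presented.
HB.instance Definition _ := Choice.on presented.

Lemma pres_piP (v w : word) :
  reflect (pres_eq v w) (\pi_presented v == \pi_presented w).
Proof. by rewrite (@eqmodE _ pres_equiv); apply: asboolP. Qed.

Lemma pres_repr (w : word) : pres_eq (repr (\pi_presented w)) w.
Proof. by apply/pres_piP; rewrite reprK. Qed.

Definition pres_one : presented := \pi_presented [::].
Definition pres_mul (g h : presented) : presented :=
  \pi_presented (repr g ++ repr h).
Definition pres_inv (g : presented) : presented :=
  \pi_presented (winv (repr g)).

Lemma winv_cat v w : winv (v ++ w) = winv w ++ winv v.
Proof. by rewrite /winv map_cat rev_cat. Qed.

Lemma winvK : involutive winv.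
Proof.
move=> w; rewrite /winv map_rev revK -map_comp -[RHS]map_id.
by apply: eq_map => -[x e] /=; rewrite negbK.
Qed.

Lemma pres_catV w : pres_eq (w ++ winv w) [::].
Proof.
elim: w => [|[x e] w IHw]; first exact: pres_refl.
rewrite -cat1s winv_cat -catA (catA w).
apply: (pres_trans (w := [:: (x, e)] ++ ([::] ++ winv [:: (x, e)]))).
  by apply: pres_cat; [exact: pres_refl|apply: pres_cat => //; exact: pres_refl].
exact: pres_cancel.
Qed.

Lemma pres_Vcat w : pres_eq (winv w ++ w) [::].
Proof. by have := pres_catV (winv w); rewrite winvK. Qed.

Lemma pres_winv v w : pres_eq v w -> pres_eq (winv v) (winv w).
Proof.
move=> vw; apply: (pres_trans (w := winv v ++ (w ++ winv w))).
  rewrite -[X in pres_eq X _]cats0; apply: pres_cat (pres_refl _) _.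
  exact/pres_sym/pres_catV.
rewrite catA -[X in pres_eq _ X]cat0s; apply: pres_cat (pres_refl _).
apply: pres_trans (pres_Vcat v).
exact: pres_cat (pres_refl _) (pres_sym vw).
Qed.

Lemma pres_piM v w :
  pres_mul (\pi_presented v) (\pi_presented w) = \pi_presented (v ++ w).
Proof. by apply/eqP/pres_piP/pres_cat; apply: pres_repr. Qed.

Lemma pres_piV w : pres_inv (\pi_presented w) = \pi_presented (winv w).
Proof. by apply/eqP/pres_piP/pres_winv/pres_repr. Qed.

Fact pres_mulA : associative pres_mul.
Proof.
move=> x y z; elim/quotW: x => x; elim/quotW: y => y; elim/quotW: z => z.
by rewrite (pres_piM y z) (pres_piM x) (pres_piM x y) (pres_piM _ z) catA.
Qed.
Fact pres_mul1g : left_id pres_one pres_mul.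
Proof. by move=> x; elim/quotW: x => x; rewrite (pres_piM [::]). Qed.
Fact pres_mulg1 : right_id pres_one pres_mul.
Proof. by move=> x; elim/quotW: x => x; rewrite (pres_piM x [::]) cats0. Qed.
Fact pres_mulVg : left_inverse pres_one pres_inv pres_mul.
Proof.
move=> x; elim/quotW: x => x; rewrite (pres_piV x) (pres_piM _ x).
exact/eqP/pres_piP/pres_Vcat.
Qed.
Fact pres_mulgV : right_inverse pres_one pres_inv pres_mul.
Proof.
move=> x; elim/quotW: x => x; rewrite (pres_piV x) (pres_piM x).
exact/eqP/pres_piP/pres_catV.
Qed.

HB.instance Definition _ := isGroup.Build presented
  pres_mulA pres_mul1g pres_mulg1 pres_mulVg pres_mulgV.

Definition pres_gen (x : X) : presented := \pi_presented [:: (x, false)].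

Local Open Scope group_scope.

Section Lift.
Variables (G : groupType) (f : X -> G).

Definition weval (w : word) : G :=
  \prod_(l <- w) (if l.2 then (f l.1)^-1 else f l.1).

Hypothesis frel : forall r, r \in rels -> weval r = 1.

Lemma weval_cat v w : weval (v ++ w) = weval v * weval w.
Proof. exact: big_cat. Qed.

Lemma weval_winv w : weval (winv w) = (weval w)^-1.
Proof.
elim: w => [|[x e] w IHw]; first by rewrite /weval /= !big_nil invg1.
rewrite -cat1s winv_cat !weval_cat IHw invgM; congr (_ * _).
by rewrite /weval !big_cons !big_nil !mulg1; case: e; rewrite //= invgK.
Qed.

Lemma weval_wexp w n : weval (wexp w n) = weval w ^+ n.
Proof.
elim: n => [|n IHn]; first by rewrite /weval big_nil.
by rewrite expgS -IHn -weval_cat.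
Qed.

Lemma weval_wcomm v w :
  weval (wcomm v w) = weval v * weval w * (weval v)^-1 * (weval w)^-1.
Proof. by rewrite !weval_cat !weval_winv !mulgA. Qed.

Lemma weval_pres v w : pres_eq v w -> weval v = weval w.
Proof.
elim=> {v w} [w|v w _ ->|v w z _ -> _ ->|v v' w w' _ vv' _ ww'|x []|r /frel ->] //.
- by rewrite !weval_cat vv' ww'.
- by rewrite /weval !big_cons big_nil mulg1 mulVg.
- by rewrite /weval !big_cons big_nil mulg1 mulgV.
- by rewrite /weval big_nil.
Qed.

Definition pres_lift of (forall r, r \in rels -> weval r = 1) :=
  fun g : presented => weval (repr g).

Local Notation lift := (pres_lift frel).

Lemma pres_lift_pi w : lift (\pi_presented w) = weval w.
Proof. exact/weval_pres/pres_repr. Qed.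

Fact pres_lift_monoid_morphism : monoid.monoid_morphism lift.
Proof.
split; first by rewrite (pres_lift_pi [::]) /weval big_nil.
move=> x y; elim/quotW: x => x; elim/quotW: y => y.
by rewrite [_ * _](pres_piM x y) (pres_lift_pi x) (pres_lift_pi y)
  (pres_lift_pi (x ++ y)) weval_cat.
Qed.

HB.instance Definition _ :=
  isUMagmaMorphism.Build presented G lift pres_lift_monoid_morphism.

Lemma pres_lift_gen x : lift (pres_gen x) = f x.
Proof. by rewrite pres_lift_pi /weval big_cons big_nil mulg1. Qed.

End Lift.
End Presentation.

Section SpecialLinear.
Local Open Scope ring_scope.

Section Def.
Variables (n : nat) (R : comNzRingType).

Record SL := MkSL { SLval :> 'M[R]_n; _ : \det SLval == 1 }.

HB.instance Definition _ := [isSub for SLval].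
HB.instance Definition _ := [Choice of SL by <:].

Implicit Types A B : SL.

Lemma det_SL A : \det A = 1. Proof. exact/eqP/(valP A). Qed.

Fact SL_one_subproof : \det (1%:M : 'M[R]_n) == 1.
Proof. by rewrite det1. Qed.
Fact SL_mul_subproof A B : \det (A *m B) == 1.
Proof. by rewrite det_mulmx !det_SL mulr1. Qed.
Fact SL_inv_subproof A : \det (\adj A) == 1.
Proof.
have := congr1 determinant (mul_mx_adj A).
by rewrite det_SL det_mulmx det_SL mul1r det1 => ->.
Qed.

Definition SL_one : SL := MkSL SL_one_subproof.
Definition SL_mul A B : SL := MkSL (SL_mul_subproof A B).
Definition SL_inv A : SL := MkSL (SL_inv_subproof A).

Fact SL_mulA : associative SL_mul.
Proof. by move=> A B C; apply/val_inj; rewrite /= mulmxA. Qed.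
Fact SL_mul1g : left_id SL_one SL_mul.
Proof. by move=> A; apply/val_inj; rewrite /= mul1mx. Qed.
Fact SL_mulg1 : right_id SL_one SL_mul.
Proof. by move=> A; apply/val_inj; rewrite /= mulmx1. Qed.
Fact SL_mulVg : left_inverse SL_one SL_inv SL_mul.
Proof. by move=> A; apply/val_inj; rewrite /= mul_adj_mx det_SL. Qed.
Fact SL_mulgV : right_inverse SL_one SL_inv SL_mul.
Proof. by move=> A; apply/val_inj; rewrite /= mul_mx_adj det_SL. Qed.

HB.instance Definition _ := isGroup.Build SL
  SL_mulA SL_mul1g SL_mulg1 SL_mulVg SL_mulgV.

End Def.

Section Map.
Variables (n : nat) (R S : comNzRingType) (f : {rmorphism R -> S}).

Fact SLmap_subproof (A : SL n R) : \det (map_mx f A) == 1.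
Proof. by rewrite det_map_mx det_SL rmorph1. Qed.

Definition SLmap (A : SL n R) : SL n S := MkSL (SLmap_subproof A).

Fact SLmap_monoid_morphism : monoid.monoid_morphism SLmap.
Proof.
split=> [|A B]; apply/val_inj; first by rewrite /= map_mx1.
by rewrite /= map_mxM.
Qed.

HB.instance Definition _ :=
  isUMagmaMorphism.Build (SL n R) (SL n S) SLmap SLmap_monoid_morphism.

End Map.

Section Unitriangular.
Variables (n : nat) (R : comNzRingType).

Definition unitri : {pred SL n R} :=
  [pred A : SL n R |
    [forall i, (A i i == 1) && [forall j : 'I_n, (j < i)%N ==> (A i j == 0)]]].

Lemma unitriP (A : SL n R) :
  reflect (forall i j : 'I_n, (j <= i)%N -> A i j = (i == j)%:R) (A \in unitri).
Proof.
apply: (iffP forallP) => [AU i j|AU i].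
  rewrite leq_eqVlt => /orP[/eqP/val_inj->|ltji].
    by have /andP[/eqP-> _] := AU i; rewrite eqxx.
  have /andP[_ /forallP/(_ j)] := AU i; rewrite ltji => /eqP->.
  by rewrite -val_eqE gtn_eqF.
rewrite AU // !eqxx; apply/forallP => j; apply/implyP => ltji.
by rewrite AU 1?ltnW // -val_eqE gtn_eqF.
Qed.

Fact unitri_one : 1%g \in unitri.
Proof. by apply/unitriP => i j _; rewrite mxE. Qed.

Fact unitri_mul : mulg_closed unitri.
Proof.
move=> A B /unitriP AU /unitriP BU; apply/unitriP => i j leji.
rewrite mxE (bigD1 i) //= AU // eqxx mul1r BU // big1 ?addr0 // => k neki.
have [leki|ltik] := leqP k i; first by rewrite AU // eq_sym (negPf neki) mul0r.
have ltjk := leq_ltn_trans leji ltik.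
by rewrite [B k j]BU 1?ltnW // -val_eqE gtn_eqF // mulr0.
Qed.

Fact unitri_inv : invg_closed unitri.
Proof.
move=> A /unitriP AU; apply/unitriP.
have AB i j : \sum_k A i k * (A^-1)%g k j = (i == j)%:R :> R.
  have := congr1 (fun C : SL n R => C i j) (mulgV A).
  by rewrite /= !mxE.
move=> i j; have [m] := ubnP (n - i); elim: m i j => // m IHm i j.
rewrite ltnS => lem leji.
rewrite -AB (bigD1 i) //= AU // eqxx mul1r big1 ?addr0 // => k neki.
have [leki|ltik] := leqP k i; first by rewrite AU // eq_sym (negPf neki) mul0r.
have ltjk := leq_ltn_trans leji ltik.
rewrite IHm; first by rewrite -val_eqE gtn_eqF // mulr0.
  exact: leq_trans (ltn_sub2l (ltn_ord i) ltik) lem.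
exact: ltnW.
Qed.

HB.instance Definition _ := isMulClosed.Build (SL n R) unitri unitri_mul.
HB.instance Definition _ := isMul1Closed.Build (SL n R) unitri unitri_one.
HB.instance Definition _ := isInvClosed.Build (SL n R) unitri unitri_inv.

End Unitriangular.
End SpecialLinear.

Inductive gens := gen_a | gen_b.

Definition bool_of_gens x := if x is gen_a then true else false.
Definition gens_of_bool (e : bool) := if e then gen_a else gen_b.
Lemma bool_of_gensK : cancel bool_of_gens gens_of_bool. Proof. by case. Qed.
HB.instance Definition _ := Choice.copy gens (can_type bool_of_gensK).

Definition Gamma_rels : seq (word gens) :=
  let a := [:: (gen_a, false)] in
  let b := [:: (gen_b, false)] in
  let ba := b ++ a in
  let aBa := a ++ winv b ++ a in
  [:: wexp ba 3; wexp aBa 3; wcomm ba aBa].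
Definition Gamma : groupType := presented Gamma_rels.
Definition Gamma_a : Gamma := pres_gen Gamma_rels gen_a.
Definition Gamma_b : Gamma := pres_gen Gamma_rels gen_b.

Definition C3_rels : seq (word unit) := [:: wexp [:: (tt, false)] 3].
Definition C3 : groupType := presented C3_rels.
Definition sigma : C3 := pres_gen C3_rels tt.

Local Open Scope group_scope.

Definition mu_gens (x : gens) : C3 :=
  match x with gen_a => sigma | gen_b => sigma ^+ 2 end.

Lemma sigma3 : sigma ^+ 3 = 1.
Proof.
have := pres_rel (mem_head (wexp [:: (tt, false)] 3) [::]).
move=> /pres_piP/eqP e; rewrite -[RHS]e.
rewrite !expgS expg0 mulg1.
by rewrite -[wexp _ _]/([:: (tt, false)] ++ [:: (tt, false)] ++ [:: (tt, false)])
  -(pres_piM C3_rels) -(pres_piM C3_rels [:: (tt, false)] [:: (tt, false)]).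
Qed.

Lemma mu_rels r : r \in Gamma_rels -> weval mu_gens r = 1.
Proof.
have ba1 : weval mu_gens [:: (gen_b, false); (gen_a, false)] = 1.
  by rewrite /weval !big_cons big_nil mulg1 /= -expgSr sigma3.
have aBa1 : weval mu_gens [:: (gen_a, false); (gen_b, true); (gen_a, false)] = 1.
  rewrite /weval !big_cons big_nil mulg1 /= expgS expg1 invgM.
  by rewrite mulgVK mulgV.
rewrite !inE => /or3P[] /eqP->; rewrite ?weval_wexp ?weval_wcomm.
- by rewrite ba1 expg1n.
- by rewrite aBa1 expg1n.
by rewrite ba1 aBa1 invg1 !mulg1.
Qed.

Definition mu : UMagmaMorphism.type Gamma C3 := pres_lift mu_rels.

Lemma mu_a : mu Gamma_a = sigma. Proof. exact: pres_lift_gen. Qed.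
Lemma mu_b : mu Gamma_b = sigma ^+ 2. Proof. exact: pres_lift_gen. Qed.

Definition Gamma0 : groupClosed Gamma := kerg mu.

Local Open Scope ring_scope.

Definition F3u : comNzRingType := {poly 'F_3}.
Definition F3t : fieldType := {fraction {poly 'F_3}}.
Definition u : F3u := 'X.
Definition t : F3t := tofrac 'X.

Definition u_to_t3 : {rmorphism F3u -> F3t} :=
  @tofrac {poly 'F_3} \o comp_poly 'X^3.

Lemma u_to_t3_u : u_to_t3 u = t ^+ 3.
Proof. by rewrite /u_to_t3 /= comp_polyX rmorphXn. Qed.

Definition SL3u_in_SL3t : UMagmaMorphism.type (SL 3 F3u) (SL 3 F3t) :=
  SLmap u_to_t3.

(* The principal congruence subgroup SL_3(F_3[u], (h)). The library's
   {poly %/ h} is F_3[u]/(h) only for h monic of positive degree (it falls back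
   to the modulus 'X otherwise). *)
Definition SLcong (h : F3u) : groupClosed (SL 3 F3u) :=
  kerg (SLmap (in_qpoly h)).

Lemma SLcongP h (A : SL 3 F3u) :
  reflect (forall i j, in_qpoly h (A i j - (i == j)%:R) = 0) (A \in SLcong h).
Proof.
apply: (iffP eqP) => [A1 i j|A1].
  have /matrixP/(_ i j) := congr1 (@SLval _ _) A1.
  by rewrite !mxE rmorphB /= => ->; rewrite rmorph_nat subrr.
apply/val_inj/matrixP => i j; rewrite !mxE.
by have /eqP := A1 i j; rewrite rmorphB rmorph_nat subr_eq0 => /eqP.
Qed.

Lemma SLcong_sub : {subset SLcong (u ^+ 2) <= SLcong u}.
Proof.
move=> A /SLcongP A1; apply/SLcongP => i j.
have /(congr1 val) /= := A1 i j.
rewrite mk_monic_Xn /= => /eqP; rewrite -/(Pdiv.Ring.rdvdp _ _).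
case/(Pdiv.RingMonic.rdvdpP (monicXn _ _)) => q ->.
have X0 : in_qpoly u u = 0 :> {poly %/ u}.
  by apply/val_inj; rewrite /= /u mk_monic_X Pdiv.RingMonic.rmodpp ?monicX.
by rewrite expr2 !rmorphM /= X0 !mulr0.
Qed.

Definition mx_of_rows (R : nzRingType) (n : nat) (rows : seq (seq R)) : 'M[R]_n :=
  \matrix_(i < n, j < n) (nth [::] rows i)`_j.

Definition sl (F : fieldType) (n : nat) : {vspace 'M[F]_n} :=
  lker (linfun (mxtrace : 'M[F]_n -> F^o)).

Lemma mem_sl (F : fieldType) n (A : 'M[F]_n) : (A \in sl F n) = (\tr A == 0).
Proof. by rewrite memv_ker lfunE. Qed.

Lemma SLcong_normal (S : groupClosed (SL 3 F3u)) :
  normal_in (capg S (SLcong (u ^+ 2))) (capg S (SLcong u)).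
Proof. exact/capg_kerg_normal/SLcong_sub. Qed.

Lemma SLcong_normal_l (S : groupClosed (SL 3 F3u)) h :
  normal_in (capg S (SLcong h)) S.
Proof. exact: capg_kerg_normal_l. Qed.

(* Main.v *)
Require Import Defs.
From HB Require Import structures.
From mathcomp Require Import all_boot all_order all_algebra generic_quotient qpoly.
From mathcomp Require Import boolp classical_sets cardinality.
From mathcomp Require Import ring zify perm.
Import GRing.Theory.
Local Open Scope ring_scope.

Set Implicit Arguments.
Unset Strict Implicit.
Unset Printing Implicit Defensive.

(* In a permuted basis, let the (pro-3) Iwahori subgroup of SL_3(F_3[u]) consist
   of the matrices that are upper unitriangular mod u. It is generated by its
   three simple affine root elements x1 = e_12(1), x2 = e_23(1), x3 = e_31(u): for two nonzero entries of a column, one of them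
   can always have its leading term cancelled by an admissible row operation, so
   a Euclidean algorithm on columns brings any element to a product of
   elementary matrices, and these are iterated commutators of the x_i.
   Writing the generators a^3, ba, ab, a^2 b a^-1 of the kernel of mu as words
   in the x_i shows that rho(Gamma0) is the kernel of the homomorphism chi from
   the Iwahori subgroup to F_3 with values 1, -1, 1 on x1, x2, x3: one inclusion
   is the check on generators, the other a Schreier argument that uses only
   x_i^3 = 1. All the assertions are then read off from the coefficients of u^0
   and u^1 of the entries. *)

(** * Elementary matrices *)

(** The default of [insubd] is taken only when [i = j] and f is nonzero; [det_elem] rules it out for
    [i != j]. *)
HB.lock Definition elem (n : nat) (R : comNzRingType) (i j : 'I_n) (f : R) :
  SL n R := insubd (SL_one n R) (1%:M + f *: delta_mx i j).

Section Elementary.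
Variables (n : nat) (R : comNzRingType).
Implicit Types (i j k l : 'I_n) (f g : R) (A B : SL n R).

Lemma SL_ext A B : (forall k l, A k l = B k l) -> A = B.
Proof. by move=> AB; apply/val_inj/matrixP => k l; apply: AB. Qed.

Lemma SL_mulE A B k l : (A * B)%g k l = \sum_m A k m * B m l.
Proof. by rewrite mxE. Qed.

Lemma SL_oneE k l : (1%g : SL n R) k l = (k == l)%:R.
Proof. by rewrite mxE. Qed.

(** The determinant is linear in row [i]; the second term involves [C], the identity with row [i]
    replaced by row [j], which has two equal rows. *)
Lemma det_elem i j f : i != j -> \det (1%:M + f *: delta_mx i j) = 1.
Proof.
move=> nij; pose C : 'M[R]_n := \matrix_(k, l) ((if k == i then j else k) == l)%:R.
rewrite (determinant_multilinear (B := 1%:M) (C := C) (i0 := i) (b := 1) (c := f)).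
- rewrite det1 (determinant_alternate (i1 := i) (i2 := j)) ?mulr0 ?addr0 ?mulr1 //.
  by move=> l; rewrite !mxE eqxx if_same.
- by apply/rowP => l; rewrite !mxE !eqxx mul1r (eq_sym l j).
- apply/matrixP => k l.
  by rewrite !mxE [lift i k == i]eq_sym (negPf (neq_lift _ _)) mulr0 addr0.
- apply/matrixP => k l.
  by rewrite !mxE [lift i k == i]eq_sym (negPf (neq_lift _ _)) mulr0 addr0.
Qed.

Lemma elemE i j f k l :
  i != j -> elem i j f k l = (k == l)%:R + f * ((k == i) && (l == j))%:R.
Proof. by move=> nij; rewrite elem.unlock val_insubd det_elem // eqxx !mxE. Qed.

Lemma elem_mulE i j f A k l :
  i != j -> (elem i j f * A)%g k l = A k l + (k == i)%:R * f * A j l.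
Proof.
move=> nij; rewrite SL_mulE.
under eq_bigr => m _ do rewrite elemE // mulrDl.
rewrite big_split /= (bigD1 k) //= eqxx mul1r big1 ?addr0; last first.
  by move=> m nmk; rewrite eq_sym (negPf nmk) mul0r.
congr (_ + _); rewrite (bigD1 j) //= eqxx andbT big1 ?addr0 1?mulrC.
  by ring.
by move=> m nmj; rewrite (negPf nmj) andbF mulr0 mul0r.
Qed.

Lemma elemD i j f g : i != j -> (elem i j f * elem i j g)%g = elem i j (f + g).
Proof.
move=> nij; apply: SL_ext => k l; rewrite elem_mulE // !elemE // eq_sym.
rewrite (eq_sym j i) (negPf nij) /= mulr0 addr0.
by case: (k == i); rewrite /= ?(eq_sym j l); ring.
Qed.

Lemma elem0 i j : i != j -> elem i j (0 : R) = 1%g.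
Proof. by move=> nij; apply: SL_ext => k l; rewrite elemE // mul0r addr0 mxE. Qed.

Lemma elemV i j f : i != j -> (elem i j f)^-1%g = elem i j (- f).
Proof.
move=> nij; apply: (mulgI (elem i j f)).
by rewrite mulgV elemD // subrr elem0.
Qed.

Lemma elemX i j f m : i != j -> (elem i j f ^+ m)%g = elem i j (f *+ m).
Proof.
move=> nij; elim: m => [|m IHm]; first by rewrite expg0 mulr0n elem0.
by rewrite expgS IHm elemD // mulrS.
Qed.

(** The Steinberg commutator relation, from which [gen_comm] obtains new root elements. *)
Lemma elem_comm i j k f g : i != j -> j != k -> i != k ->
  (elem i j f * elem j k g * (elem i j f)^-1 * (elem j k g)^-1)%g =
    elem i k (f * g).
Proof.
move=> nij njk nik; apply: (mulIg (elem j k g)); rewrite mulgVK.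
apply: (mulIg (elem i j f)); rewrite mulgVK -mulgA.
apply: SL_ext => a b; rewrite !elem_mulE // !elemE // (eq_sym k i) (eq_sym k j).
rewrite (negPf njk) (negPf nik) eqxx /= (eq_sym j b) (eq_sym k b) -!mulnb !natrM.
by ring.
Qed.

End Elementary.

Section Permutation.
Variables (n : nat) (R : comNzRingType) (s : 'S_n).

Fact SLperm_subproof (A : SL n R) :
  \det (row_perm s (col_perm s (SLval A))) == 1.
Proof.
rewrite row_permE col_permE !det_mulmx !det_perm det_SL mul1r odd_permV.
by rewrite -signr_addb addbb.
Qed.

Definition SLperm (A : SL n R) : SL n R := MkSL (SLperm_subproof A).

Lemma SLpermE A i j : SLperm A i j = A (s i) (s j).
Proof. by rewrite !mxE. Qed.

Fact SLperm_monoid_morphism : monoid.monoid_morphism SLperm.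
Proof.
split=> [|A B]; apply: SL_ext => i j; rewrite SLpermE.
  by rewrite !SL_oneE (inj_eq perm_inj).
rewrite !SL_mulE (reindex_inj (@perm_inj _ s)).
by apply: eq_bigr => k _; rewrite !SLpermE.
Qed.

HB.instance Definition _ :=
  isUMagmaMorphism.Build (SL n R) (SL n R) SLperm SLperm_monoid_morphism.

End Permutation.

(** * Indices, sums and determinants in dimension three *)

Definition o0 : 'I_3 := @Ordinal 3 0 isT.
Definition o1 : 'I_3 := @Ordinal 3 1 isT.
Definition o2 : 'I_3 := @Ordinal 3 2 isT.

Lemma ord3_ind (Q : 'I_3 -> Prop) : Q o0 -> Q o1 -> Q o2 -> forall i, Q i.
Proof.
move=> Q0 Q1 Q2 [[|[|[|//]]] lti].
- by congr Q: Q0; apply/val_inj.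
- by congr Q: Q1; apply/val_inj.
- by congr Q: Q2; apply/val_inj.
Qed.

Lemma sum3 (V : nmodType) (F : 'I_3 -> V) : \sum_i F i = F o0 + F o1 + F o2.
Proof.
rewrite !big_ord_recr big_ord0 /= add0r.
by congr (F _ + F _ + F _); apply/val_inj.
Qed.

Lemma det3 (R : comNzRingType) (M : 'M[R]_3) :
  \det M = M o0 o0 * (M o1 o1 * M o2 o2 - M o1 o2 * M o2 o1)
         - M o0 o1 * (M o1 o0 * M o2 o2 - M o1 o2 * M o2 o0)
         + M o0 o2 * (M o1 o0 * M o2 o1 - M o1 o1 * M o2 o0).
Proof.
rewrite (expand_det_row _ o0) sum3 /cofactor !(expand_det_row _ ord0).
rewrite !big_ord_recl !big_ord0 /cofactor !det_mx11 !mxE /=.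
have -> : lift (lift ord0 ord0) 0 = ord0 :> 'I_2 by apply/val_inj.
have [-> -> ->] : [/\ lift o0 ord0 = o1, lift o0 (lift ord0 ord0) = o2
  & lift o1 ord0 = o0] by split; apply/val_inj.
have [-> -> ->] : [/\ lift o1 (lift ord0 ord0) = o2, lift o2 ord0 = o0
  & lift o2 (lift ord0 ord0) = o1] by split; apply/val_inj.
by rewrite /bump /=; ring.
Qed.

(** * The Iwahori subgroup *)

(* The position of i in the order 1 < 0 < 2 of the basis in which rho(Gamma0) is
   upper unitriangular mod u. *)
Definition pos (i : 'I_3) : nat := nth 0%N [:: 1; 0; 2]%N i.
(* The (i, j) entry of an element of the Iwahori subgroup, i != j, may be any
   multiple of u^(depth i j). *)
Definition depth (i j : 'I_3) : nat := (pos j < pos i)%N.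

Lemma depth_sym i j : i != j -> (depth i j + depth j i)%N = 1%N.
Proof. by elim/ord3_ind: i => //; elim/ord3_ind: j. Qed.

Definition swap01 : 'S_3 := tperm o0 o1.

Lemma pos_swap01 i : pos (swap01 i) = i.
Proof. by rewrite permE /=; elim/ord3_ind: i. Qed.

Lemma swap01_pos i : swap01 i = pos i :> nat.
Proof. by rewrite permE /=; elim/ord3_ind: i. Qed.

Definition at0 : {rmorphism F3u -> 'F_3} := horner_eval (0 : 'F_3).

Lemma at0E f : at0 f = f`_0.
Proof. exact: horner_coef0. Qed.

(** Reduction mod u, followed by the exchange of the first two basis vectors, which turns the order
    1 < 0 < 2 into the standard one of [unitri]. *)
Definition residue : UMagmaMorphism.type (SL 3 F3u) (SL 3 'F_3) :=
  SLperm swap01 \o SLmap at0.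

Lemma residueE A i j : residue A i j = (A (swap01 i) (swap01 j))`_0.
Proof. by rewrite /residue SLpermE mxE at0E. Qed.

Definition iwahori : groupClosed (SL 3 F3u) :=
  preimg residue (@unitri 3 'F_3).

Lemma iwahoriP (A : SL 3 F3u) :
  reflect (forall i j, (pos j <= pos i)%N -> (A i j)`_0 = (i == j)%:R)
          (A \in iwahori).
Proof.
apply: (iffP (unitriP _)) => AI i j leji.
  have := AI (swap01 i) (swap01 j); rewrite residueE !tpermK !swap01_pos.
  by rewrite (inj_eq perm_inj); apply.
by rewrite residueE AI ?pos_swap01 // (inj_eq perm_inj).
Qed.

Lemma F3u_mul3 (f : F3u) : f *+ 3 = 0.
Proof.
rewrite -mulr_natr; suff ->: 3%:R = 0 :> F3u by rewrite mulr0.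
by apply: (pcharf0 (p := 3)); rewrite pchar_poly pchar_Fp.
Qed.

Lemma coef_natb k (b : bool) : (b%:R : F3u)`_k = (b && (k == 0%N))%:R.
Proof. by case: b; rewrite ?coef1 ?coef0. Qed.

Lemma coef_mul_natb (f : F3u) k (b : bool) : (f * b%:R)`_k = f`_k * b%:R.
Proof. by case: b; rewrite ?mulr1 ?mulr0 ?coef0. Qed.

Lemma coef_scale_u (c : 'F_3) k : (c *: u)`_k = c * (k == 1%N)%:R.
Proof. by rewrite coefZ coefX. Qed.

Lemma coef1M (R : nzSemiRingType) (p q : {poly R}) :
  (p * q)`_1 = p`_0 * q`_1 + p`_1 * q`_0.
Proof. by rewrite coefM !big_ord_recl big_ord0 addr0. Qed.

Lemma scale_F3E (c : 'F_3) (f : F3u) : c *: f = f *+ (c : nat).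
Proof. by rewrite -scaler_nat natr_Zp. Qed.

Definition x1 : SL 3 F3u := elem o1 o0 1.
Definition x2 : SL 3 F3u := elem o0 o2 1.
Definition x3 : SL 3 F3u := elem o2 o1 u.

Lemma elem_iwahori i j (f : F3u) :
  i != j -> elem i j (f * 'X^(depth i j))%R \in iwahori.
Proof.
move=> nij; apply/iwahoriP => k l lelk; rewrite elemE // coefD coef_natb andbT.
have [/andP[/eqP ki /eqP lj]|_] := boolP ((k == i) && (l == j)); last first.
  by rewrite mulr0 coef0 addr0.
rewrite mulr1 /depth; move: lelk; rewrite ki lj leq_eqVlt.
have -> : (pos j == pos i) = false.
  by move: nij; elim/ord3_ind: (i); elim/ord3_ind: (j).
by move=> /= ->; rewrite coefMX addr0.
Qed.

(** In the order 1 < 0 < 2 such an [A] is upper triangular of determinant 1. Its diagonal entries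
    divide 1, so they are constants, and the Iwahori condition makes them 1. *)
Lemma iwahori_triangular A : A \in iwahori ->
  A o0 o1 = 0 -> A o2 o1 = 0 -> A o2 o0 = 0 ->
  A = (elem o0 o2 (A o0 o2) * elem o1 o2 (A o1 o2) * elem o1 o0 (A o1 o0))%g.
Proof.
move=> /iwahoriP IA A01 A21 A20.
have diag1 i f : (A i i * f) = 1 -> A i i = 1.
  move=> Af; have : (size (A i i * f)%R == 1)%N by rewrite Af size_poly1.
  rewrite size_mul_eq1 => /andP[/eqP/eq_leq/size1_polyC-> _].
  by rewrite IA // eqxx.
have detA : (A o0 o0 * (A o1 o1 * A o2 o2) = 1).
  by rewrite -(det_SL A) det3 A01 A21 A20; ring.
have A00 : A o0 o0 = 1 by apply: diag1 detA.
have A11 : A o1 o1 = 1 by apply: (diag1 _ (A o0 o0 * A o2 o2)); rewrite -detA; ring.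
have A22 : A o2 o2 = 1 by apply: (diag1 _ (A o0 o0 * A o1 o1)); rewrite -detA; ring.
apply: SL_ext => k l; rewrite -mulgA !elem_mulE // !elemE //.
by elim/ord3_ind: k; elim/ord3_ind: l;
  rewrite ?A01 ?A21 ?A20 ?A00 ?A11 ?A22 /=; ring.
Qed.

(** * Generation of the Iwahori subgroup *)

Section Leading.
Variable F : fieldType.
Implicit Types p q : {poly F}.

Definition lead_cancel p q : {poly F} :=
  - (lead_coef p / lead_coef q) *: 'X^(size p - size q).

Lemma size_lead_cancel p q : p != 0 -> q != 0 -> (size q <= size p)%N ->
  (size (p + lead_cancel p q * q)%R < size p)%N.
Proof.
move=> p0 q0 leqp; have sp : (0 < size p)%N by rewrite size_poly_gt0.
have sq : (0 < size q)%N by rewrite size_poly_gt0.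
rewrite -[X in (_ < X)%N](prednK sp) ltnS; apply/leq_sizeP => k lek.
rewrite coefD -scalerAl coefZ coefXnM.
have -> : (k < size p - size q)%N = false.
  apply/negbTE; rewrite -leqNgt; apply: leq_trans lek.
  by rewrite -subn1 leq_sub2l.
have [->|nk] := eqVneq k (size p).-1; last first.
  have ltk : (size p <= k)%N by rewrite -(prednK sp) ltn_neqAle eq_sym nk.
  rewrite (nth_default _ ltk) add0r nth_default ?mulr0 //.
  by apply: leq_trans (leq_sub2r _ ltk); rewrite subKn.
rewrite -lead_coefE; have -> : ((size p).-1 - (size p - size q))%N = (size q).-1.
  by rewrite -subn1 subnAC subKn // subn1.
by rewrite -lead_coefE mulNr divfK ?subrr // lead_coef_eq0.
Qed.

End Leading.

Section Generation.
Local Open Scope group_scope.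
(** [P] is a property closed under products rather than a subgroup, because [kerchi_sub] applies the
    induction to a property of that kind. *)
Variable P : SL 3 F3u -> Prop.
Hypothesis PM : forall A B, P A -> P B -> P (A * B).
Hypotheses (P1 : P x1) (P2 : P x2) (P3 : P x3).

Lemma gen_one : P 1.
Proof.
have <- : x1 ^+ 3 = 1 by rewrite elemX // F3u_mul3 elem0.
by rewrite 2!expgS expg1; do 2!apply: PM => //.
Qed.

(** In characteristic 3 the cube of an elementary matrix is 1, so its inverse is its square. *)
Lemma gen_inv i j f : i != j -> P (elem i j f) -> P (elem i j f)^-1.
Proof.
move=> nij Pf; suff -> : (elem i j f)^-1 = elem i j f * elem i j f by apply: PM.
apply: (mulgI (elem i j f)); rewrite mulgV !elemD //.
by rewrite (F3u_mul3 f : (f + (f + f) = 0)%R) elem0.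
Qed.

Lemma gen_mulrn i j f m :
  i != j -> P (elem i j f) -> P (elem i j (f *+ m)%R).
Proof.
move=> nij Pf; rewrite -elemX //; elim: m => [|m IHm].
  by rewrite expg0; apply: gen_one.
by rewrite expgS; apply: PM.
Qed.

Lemma gen_comm i j k f g : i != j -> j != k -> i != k ->
  P (elem i j f) -> P (elem j k g) -> P (elem i k (f * g)%R).
Proof.
move=> nij njk nik Pf Pg; rewrite -(elem_comm f g nij njk nik).
by do !apply: PM => //; apply: gen_inv.
Qed.

Lemma gen_commX i j k a b : i != j -> j != k -> i != k ->
  P (elem i j 'X^a) -> P (elem j k 'X^b) -> P (elem i k 'X^(a + b)).
Proof. by rewrite exprD; apply: gen_comm. Qed.

Lemma gen_depth i j : i != j -> P (elem i j 'X^(depth i j)).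
Proof.
have Q10 : P (elem o1 o0 'X^0) by rewrite expr0.
have Q02 : P (elem o0 o2 'X^0) by rewrite expr0.
have Q21 : P (elem o2 o1 'X^1) by rewrite expr1.
have Q12 : P (elem o1 o2 'X^0) by apply: (@gen_commX o1 o0 o2 0 0).
have Q01 : P (elem o0 o1 'X^1) by apply: (@gen_commX o0 o2 o1 0 1).
have Q20 : P (elem o2 o0 'X^1) by apply: (@gen_commX o2 o1 o0 1 0).
by elim/ord3_ind: i; elim/ord3_ind: j.
Qed.

(** Commutators raise the degree by one: [Q10], [Q02] and [Q21] come from the induction hypothesis
    and an element of minimal degree, the other three from [Q10] or [Q02]. *)
Lemma gen_monomial k i j : i != j -> P (elem i j 'X^(depth i j + k)).
Proof.
elim: k i j => [|k IHk] i j nij; first by rewrite addn0; apply: gen_depth.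
have Q10 : P (elem o1 o0 'X^(0 + k.+1)).
  have -> : (0 + k.+1 = k + 1)%N by rewrite addn1.
  exact: (@gen_commX o1 o2 o0 k 1 _ _ _ (IHk o1 o2 _) (@gen_depth o2 o0 _)).
have Q02 : P (elem o0 o2 'X^(0 + k.+1)).
  exact: (@gen_commX o0 o1 o2 1 k _ _ _ (@gen_depth o0 o1 _) (IHk o1 o2 _)).
have Q12 : P (elem o1 o2 'X^(0 + k.+1)).
  exact: (@gen_commX o1 o0 o2 0 k.+1 _ _ _ (@gen_depth o1 o0 _)).
have Q01 : P (elem o0 o1 'X^(1 + k.+1)).
  rewrite addnC; exact: (@gen_commX o0 o2 o1 k.+1 1 _ _ _ _ (@gen_depth o2 o1 _)).
have Q20 : P (elem o2 o0 'X^(1 + k.+1)).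
  exact: (@gen_commX o2 o1 o0 1 k.+1 _ _ _ (@gen_depth o2 o1 _)).
have Q21 : P (elem o2 o1 'X^(1 + k.+1)).
  exact: (@gen_commX o2 o0 o1 1 k.+1 _ _ _ (@gen_depth o2 o0 _) (IHk o0 o1 _)).
by elim/ord3_ind: i nij; elim/ord3_ind: j.
Qed.

(** The polynomial splits into monomials; a coefficient in F_3 acts as a natural multiple, that is,
    as a power of the elementary matrix. *)
Lemma gen_elem i j f : i != j -> P (elem i j (f * 'X^(depth i j))%R).
Proof.
move=> nij; rewrite -[f]coefK poly_def mulr_suml.
elim/big_ind: _ => [|g h Pg Ph|k _].
- by rewrite elem0 //; apply: gen_one.
- by rewrite -elemD //; apply: PM.
rewrite -scalerAl -exprD scale_F3E addnC.
exact/gen_mulrn/gen_monomial.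
Qed.

(** Euclid's algorithm in column [j] by operations among the rows in [T]; each step lowers the sum
    of the sizes. The last clause protects columns that are already zero on [T], and [P B^-1] allows
    passing from [B * A] back to [A]. *)
Lemma column_reduce (T : {set 'I_3}) j A : exists B,
  [/\ P B^-1, B \in iwahori,
      {in T &, forall i k, i != k -> (B * A) i j = 0%R \/ (B * A) k j = 0%R}
    & forall l, {in T, forall i, A i l = 0%R} ->
                {in T, forall i, (B * A) i l = 0%R}].
Proof.
have [m] := ubnP (\sum_(i in T) size (A i j)).
elim: m A => // m IHm A; rewrite ltnS => lem.
have [] := boolP [exists i in T, exists k in T,
  [&& i != k, A i j != 0%R, A k j != 0%R & size (A k j) + depth i k <= size (A i j)]%N].
- case/exists_inP => i Ti /exists_inP[k Tk /and4P[nik Ai0 Ak0 les]].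
  pose g := lead_cancel (A i j) (A k j).
  (* The exponent in [lead_cancel] is at least [depth i k], so the row operation lies in the Iwahori
     subgroup. *)
  have [f gE] : exists f, g = (f * 'X^(depth i k))%R.
    exists (- (lead_coef (A i j) / lead_coef (A k j)) *:
               'X^(size (A i j) - size (A k j) - depth i k))%R.
    by rewrite -scalerAl -exprD subnK // leq_subRL // (leq_trans (leq_addr _ _) les).
  pose B0 := elem i k g.
  have B0E a l : (B0 * A) a l = (A a l + (a == i)%:R * g * A k l)%R.
    exact: elem_mulE.
  have [|B [PB IB BT B0T]] := IHm (B0 * A).
    apply: leq_trans lem; rewrite (bigD1 i) // [X in (_ < X)%N](bigD1 i) //=.
    rewrite B0E eqxx mul1r -addSn leq_add //.
      apply: size_lead_cancel => //; exact: leq_trans (leq_addr _ _) les.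
    apply: leq_sum => a /andP[_ nai].
    by rewrite B0E (negPf nai) !mul0r addr0.
  exists (B * B0); rewrite -mulgA; split=> //.
  - by rewrite invgM; apply: PM => //; apply: gen_inv; rewrite // gE; apply: gen_elem.
  - by rewrite gpredM // /B0 gE elem_iwahori.
  - by move=> l Al; apply: B0T => a Ta; rewrite B0E !Al // mulr0 addr0.
rewrite negb_exists_in => /forall_inP nred.
exists 1; rewrite mul1g; split=> //; first by rewrite invg1; apply: gen_one.
  exact: gpred1.
move=> i k Ti Tk nik.
have [->|Ai0] := eqVneq (A i j) 0%R; first by left.
have [->|Ak0] := eqVneq (A k j) 0%R; first by right.
have /exists_inPn/(_ k Tk) := nred i Ti.
have /exists_inPn/(_ i Ti) := nred k Tk.
rewrite nik (eq_sym k i) nik Ai0 Ak0 /= -!ltnNge.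
(* One of the two depths is 0 and the other 1, so the two strict inequalities between the sizes
   contradict each other. *)
have := depth_sym nik; move: (depth _ _) (depth _ _) => a b; lia.
Qed.

Lemma iwahori_gen A : A \in iwahori -> P A.
Proof.
move=> IA.
have PI C B : P B^-1 -> P (B * C) -> P C.
  by move=> PB PBC; rewrite -(mulKg B C); apply: PM.
have diag0 B i : B \in iwahori -> B i i != 0%R.
  move=> /iwahoriP IB; apply/eqP => Bii.
  by have := IB i i (leqnn _); rewrite Bii coef0 eqxx => /esym/eqP; rewrite oner_eq0.
(* In column [o1] the surviving entry is the diagonal one, whose constant term is 1. *)
have [B [PB IB B1 _]] := column_reduce [set: 'I_3]%SET o1 A.
apply: (PI A B) => //; have {}IA : B * A \in iwahori by rewrite gpredM.
move: (B * A) IA B1 => {PB IB}A IA A1.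
have {}A1 i : i != o1 -> A i o1 = 0%R.
  move=> ni1; have [] := A1 i o1 (finset.in_setT _) (finset.in_setT _) ni1 => // A11.
  by have := diag0 A o1 IA; rewrite A11 eqxx.
(* Row [o1] is left out, so that column [o1] stays zero on the rows [o0] and [o2]. *)
have [B' [PB IB B0 B1]] := column_reduce [set o0; o2]%SET o0 A.
apply: (PI A B') => //; have {}IA : B' * A \in iwahori by rewrite gpredM.
have {}A1 i : i \in [set o0; o2]%SET -> (B' * A) i o1 = 0%R.
  by apply: B1 => k; rewrite !inE => /orP[] /eqP->; apply: A1.
move: (B' * A) IA B0 A1 => {PB IB B1}A IA A0 A1.
have A20 : A o2 o0 = 0%R.
  have [] := A0 o2 o0 _ _ isT; rewrite ?inE // => A00.
  by have := diag0 A o0 IA; rewrite A00 eqxx.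
rewrite (iwahori_triangular IA) // ?A1 ?inE //.
have gen0 i j f : i != j -> depth i j = 0%N -> P (elem i j f).
  by move=> nij dij; have := gen_elem f nij; rewrite dij mulr1.
by apply: PM; [apply: PM|]; apply: gen0.
Qed.

End Generation.

(** * The homomorphism chi *)

Definition chi (A : SL 3 F3u) : 'F_3 :=
  (A o1 o0)`_0 - (A o0 o2)`_0 + (A o2 o1)`_1.

(** The three coefficients are the simple affine root coordinates. In each of them the mixed terms
    of the product contain a constant term that vanishes on the Iwahori subgroup. *)
Lemma chiM A B : A \in iwahori -> B \in iwahori -> chi (A * B)%g = chi A + chi B.
Proof.
move=> /iwahoriP IA /iwahoriP IB; rewrite /chi !SL_mulE !sum3 !coefD.
rewrite !coef0M !coef1M.
rewrite (IA o0 o0) // (IA o0 o1) // (IA o1 o1) // (IA o2 o0) // (IA o2 o1) //.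
rewrite (IA o2 o2) // (IB o0 o0) // (IB o0 o1) // (IB o1 o1) // (IB o2 o0) //.
by rewrite (IB o2 o1) // (IB o2 o2) //=; ring.
Qed.

Definition kerchi : {pred SL 3 F3u} :=
  [pred A | (A \in iwahori) && (chi A == 0)].

Fact chi1 : chi 1%g = 0.
Proof. by rewrite /chi !mxE /= !coef0 subr0 addr0. Qed.

Lemma chiV A : A \in iwahori -> chi (A^-1)%g = - chi A.
Proof.
move=> IA; apply/eqP; rewrite -addr_eq0 -chiM ?gpredVr //.
by rewrite mulVg chi1.
Qed.

Fact kerchi_mul : mulg_closed kerchi.
Proof.
move=> A B /andP[IA /eqP A0] /andP[IB /eqP B0].
by rewrite inE gpredM //= chiM // A0 B0 addr0.
Qed.
Fact kerchi_one : 1%g \in kerchi.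
Proof. by rewrite inE gpred1 chi1 eqxx. Qed.
Fact kerchi_inv : invg_closed kerchi.
Proof.
by move=> A /andP[IA /eqP A0]; rewrite inE gpredVr // chiV // A0 oppr0 eqxx.
Qed.

HB.instance Definition _ := isMulClosed.Build (SL 3 F3u) kerchi kerchi_mul.
HB.instance Definition _ := isMul1Closed.Build (SL 3 F3u) kerchi kerchi_one.
HB.instance Definition _ := isInvClosed.Build (SL 3 F3u) kerchi kerchi_inv.

Lemma x1_iwahori : x1 \in iwahori.
Proof. by have := @elem_iwahori o1 o0 1 isT; rewrite mulr1. Qed.
Lemma x2_iwahori : x2 \in iwahori.
Proof. by have := @elem_iwahori o0 o2 1 isT; rewrite mulr1. Qed.
Lemma x3_iwahori : x3 \in iwahori.
Proof. by have := @elem_iwahori o2 o1 1 isT; rewrite mul1r. Qed.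

Lemma chi_elem i j f : i != j -> chi (elem i j f) =
  f`_0 * ((o1 == i) && (o0 == j))%:R - f`_0 * ((o0 == i) && (o2 == j))%:R
  + f`_1 * ((o2 == i) && (o1 == j))%:R.
Proof. by move=> nij; rewrite /chi !elemE //= !add0r !coef_mul_natb. Qed.

Lemma chi_x1 : chi x1 = 1.
Proof. by rewrite chi_elem //= !coef1 /=; ring. Qed.
Lemma chi_x2 : chi x2 = -1.
Proof. by rewrite chi_elem //= !coef1 /=; ring. Qed.
Lemma chi_x3 : chi x3 = 1.
Proof. by rewrite chi_elem //= !coefX /=; ring. Qed.

(* The images of a^3, ba, ab and a^2 b a^-1, the Schreier generators of Gamma0
   for the transversal 1, a, a^2. *)
Definition im_a3 := (x3 * x2^-1 * x1)%g.
Definition im_ba := (x3^-1 * x1)%g.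
Definition im_ab := (x3 * x2)%g.
Definition im_aabA := (x3 * x2^-1 * x1^-1 * x3^-1)%g.

Section Words.

Let iwM := (x1_iwahori, x2_iwahori, x3_iwahori).

Lemma im_a3_ker : im_a3 \in kerchi.
Proof.
rewrite inE /im_a3 !(gpredM, gpredVr, iwM) //= !(chiM, chiV, gpredM, gpredVr, iwM) //.
by rewrite chi_x1 chi_x2 chi_x3.
Qed.
Lemma im_ba_ker : im_ba \in kerchi.
Proof.
rewrite inE /im_ba !(gpredM, gpredVr, iwM) //= !(chiM, chiV, gpredM, gpredVr, iwM) //.
by rewrite chi_x1 chi_x3.
Qed.
Lemma im_ab_ker : im_ab \in kerchi.
Proof.
rewrite inE /im_ab !(gpredM, gpredVr, iwM) //= !(chiM, chiV, gpredM, gpredVr, iwM) //.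
by rewrite chi_x2 chi_x3.
Qed.
Lemma im_aabA_ker : im_aabA \in kerchi.
Proof.
rewrite inE /im_aabA !(gpredM, gpredVr, iwM) //= !(chiM, chiV, gpredM, gpredVr, iwM) //.
by rewrite chi_x1 chi_x2 chi_x3.
Qed.

End Words.

Lemma x1_cube : (x1 ^+ 3 = 1)%g. Proof. by rewrite elemX // F3u_mul3 elem0. Qed.
Lemma x2_cube : (x2 ^+ 3 = 1)%g. Proof. by rewrite elemX // F3u_mul3 elem0. Qed.
Lemma x3_cube : (x3 ^+ 3 = 1)%g. Proof. by rewrite elemX // F3u_mul3 elem0. Qed.

Lemma x3_pow k : (x3 ^+ k)%g \in iwahori /\ chi (x3 ^+ k)%g = k%:R.
Proof.
elim: k => [|k [IHI IHk]]; first by rewrite gpred1 chi1.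
by rewrite expgS gpredM ?x3_iwahori // chiM ?x3_iwahori // IHk chi_x3 mulrS.
Qed.

Lemma cube_inv (G : groupType) (x : G) :
  (x ^+ 3 = 1 -> x^-1 = x * x)%g.
Proof. by move=> xxx; apply: (mulgI x); rewrite mulgV -xxx !expgS expg0 mulg1. Qed.

Section Schreier.
Local Open Scope group_scope.
Variables (S : groupClosed (SL 3 F3u)).
Hypotheses (Sp : im_a3 \in S) (Sq : im_ba \in S).
Hypotheses (Sr : im_ab \in S) (Ss : im_aabA \in S).
Hypothesis (S_ker : {subset S <= kerchi}).

(** A Schreier argument with the powers of [x3] as transversal: some power of [x3] carries a given
    Iwahori element into [S], and for an element of [kerchi] the value of [chi] shows that this
    power is trivial. *)
Lemma kerchi_sub : {subset kerchi <= S}.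
Proof.
have y3 := cube_inv x3_cube.
(* With x3^-1 x1 and x3 x2, the next four elements are the Schreier generators of
   ker chi for the transversal 1, x3, x3^2. *)
have y_1_y : x3 * x1 * x3 \in S.
  have -> : x3 * x1 * x3 = im_aabA^-1 * (im_a3 * im_ba^-1).
    by rewrite /im_aabA /im_a3 /im_ba !invgM !invgK !mulgA mulgK mulgVK mulgK.
  by rewrite !(Ss, Sp, Sq, gpredM, gpredVr).
have n1_Y : x1 * x3^-1 \in S.
  have -> : x1 * x3^-1 = (x3 * x1 * x3 * im_ba)^-1.
    apply: (mulIg (x3 * x1 * x3 * im_ba)); rewrite mulVg /im_ba !mulgA mulgVK mulgK.
    by rewrite -x1_cube !expgS expg0 mulg1 mulgA.
  by rewrite !(y_1_y, Sq, gpredM, gpredVr).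
have Y_2_Y : x3^-1 * x2 * x3^-1 \in S.
  have -> : x3^-1 * x2 * x3^-1 = (im_a3 * im_ba^-1)^-1.
    by rewrite /im_a3 /im_ba !invgM !invgK !mulgA mulgK.
  by rewrite !(Sp,Sq,gpredM,gpredVr).
have n2_y : x2 * x3 \in S.
  have -> : x2 * x3 = (x3^-1 * x2 * x3^-1 * im_ab)^-1.
    apply: (mulIg (x3^-1 * x2 * x3^-1 * im_ab)); rewrite mulVg /im_ab !mulgA mulgK.
    by rewrite mulgVK -x2_cube !expgS expg0 mulg1 mulgA.
  by rewrite !(Y_2_Y,Sr,gpredM,gpredVr).
move=> A /andP[IA /eqP A0].
have [k Sk] : exists k, A * x3 ^+ k \in S.
  (* Quantifying over the left power [j] makes the property closed under products, as [iwahori_gen]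
     requires. *)
  suff /(_ 0%N) [k] : forall j, exists k, x3 ^+ j * A * x3 ^+ k \in S.
    by rewrite expg0 mul1g; exists k.
  have modj j : x3 ^+ j = x3 ^+ (j %% 3).
    by rewrite {1}(divn_eq j 3) expgnDr mulnC expgnA x3_cube expg1n mul1g.
  have lt3 (Q : nat -> Prop) : Q 0%N -> Q 1%N -> Q 2%N -> forall j, (j < 3)%N -> Q j.
    by move=> Q0 Q1 Q2 [|[|[|//]]].
  move: A IA {A0}; apply: iwahori_gen => [A B IHA IHB j|j|j|j].
  (* The exponent 2k inverts the k-th power of [x3], so the inner powers cancel. *)
  - have [k Ak] := IHA j; have [l Bl] := IHB (2 * k)%N.
    exists l; have := gpredM _ _ Ak Bl.
    have <- : x3 ^+ j * A * x3 ^+ k * (x3 ^+ (2 * k) * B * x3 ^+ l)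
      = x3 ^+ j * (A * B) * x3 ^+ l; last by [].
    rewrite !mulgA -(mulgA _ (x3 ^+ k)) -expgnDr -mulSn expgnA x3_cube expg1n.
    by rewrite mulg1.
  - rewrite (modj j); move: (j %% 3)%N (ltn_pmod j (isT : (0 < 3)%N)).
    apply: lt3; rewrite ?expg0 ?mul1g ?expg1.
    + by exists 2%N; rewrite expgS expg1 -y3.
    + by exists 1%N; rewrite expg1.
    + by exists 0%N; rewrite mulg1 expgS expg1 -y3.
  - rewrite (modj j); move: (j %% 3)%N (ltn_pmod j (isT : (0 < 3)%N)).
    apply: lt3; rewrite ?expg0 ?mul1g ?expg1.
    + by exists 1%N; rewrite expg1.
    + by exists 0%N; rewrite mulg1.
    + by exists 2%N; rewrite expgS expg1 -y3.
  exists (2 * j + 2)%N; rewrite -expgSr -expgnDr.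
  have -> : (j.+1 + (2 * j + 2) = 3 * j.+1)%N by lia.
  by rewrite expgnA x3_cube expg1n gpred1.
have /andP[_] := S_ker Sk; rewrite chiM ?(x3_pow k).1 // A0 add0r (x3_pow k).2 => k0.
have /dvdnP[m km] : (3 %| k)%N by rewrite (dvdn_pcharf (R := 'F_3)) ?pchar_Fp.
by move: Sk; rewrite km mulnC expgnA x3_cube expg1n mulg1.
Qed.

End Schreier.

(** * The representation rho *)

Lemma t_neq0 : t != 0.
Proof. by rewrite tofrac_eq0 polyX_eq0. Qed.

Lemma F3t_2 : 2 = -1 :> F3t.
Proof.
have : tofrac (1 *+ 3 : F3u) = 0 by rewrite F3u_mul3 rmorph0.
by rewrite rmorphMn rmorph1 /= => F3; apply/eqP; rewrite -addr_eq0 -F3; apply/eqP; ring.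
Qed.

Lemma SLmap_elem n (R S : comNzRingType) (f : {rmorphism R -> S}) i j (x : R) :
  i != j -> SLmap f (@elem n R i j x) = elem i j (f x).
Proof.
move=> nij; apply: SL_ext => k l; rewrite mxE !elemE // rmorphD rmorphM /=.
by rewrite !rmorph_nat.
Qed.

(** Substituting X^3 multiplies degrees by 3, so a kernel element is constant, and constants are
    fixed. *)
Lemma u_to_t3_inj : injective u_to_t3.
Proof.
move=> f g /eqP; rewrite tofrac_eq -subr_eq0 -raddfB /= => /eqP fg.
have sfg : (size (f - g)%R <= 1)%N.
  have := size_comp_poly (f - g) 'X^3; rewrite fg size_poly0 size_polyXn /=.
  by case: (size (f - g)) => [|[|]].
apply/eqP; rewrite -subr_eq0; move: fg; rewrite (size1_polyC sfg) comp_polyC.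
by move=> ->.
Qed.

Lemma SL3u_in_SL3t_inj : injective SL3u_in_SL3t.
Proof.
move=> A B AB; apply: SL_ext => i j; apply: u_to_t3_inj.
by have := congr1 (fun C : SL 3 F3t => C i j) AB; rewrite !mxE.
Qed.

(** * Matrix identities over an abstract field, applied later with z = t *)

Section Matrices.
Variables (F : fieldType) (z : F).
Hypotheses (z0 : z != 0) (F2 : 2 = -1 :> F).

Definition mx_a : 'M[F]_3 :=
  mx_of_rows 3 [:: [:: 0;          0;          1 / z];
                   [:: 2 / z;      0;          0    ];
                   [:: 2 * z ^+ 2; 2 * z ^+ 2; 0    ]].
Definition mx_b : 'M[F]_3 :=
  mx_of_rows 3 [:: [:: 0; 2 * z; 0         ];
                   [:: 0; 0;     2 / z ^+ 2];
                   [:: z; 0;     z         ]].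

Lemma det_a : \det mx_a = 1.
Proof. by rewrite det3 !mxE /= F2; field. Qed.
Lemma det_b : \det mx_b = 1.
Proof. by rewrite det3 !mxE /= F2; field. Qed.

(** In this and the next three identities the elementary factors involve [z] only through its cube.
    At z = t this puts the images of ba, ab, a^3 and a^2 b a^-1 in SL_3(F_3[u]). *)
Lemma mx_b_a : mx_b *m mx_a =
  (elem o2 o1 (- z ^+ 3) * elem o1 o0 1 : SL 3 F)%g.
Proof.
apply/matrixP => k l; rewrite elem_mulE // !elemE // mxE sum3 !mxE.
by elim/ord3_ind: k; elim/ord3_ind: l; rewrite /= ?F2; field.
Qed.

Lemma mx_a_b : mx_a *m mx_b = (elem o2 o1 (z ^+ 3) * elem o0 o2 1 : SL 3 F)%g.
Proof.
apply/matrixP => k l; rewrite elem_mulE // !elemE // mxE sum3 !mxE.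
by elim/ord3_ind: k; elim/ord3_ind: l; rewrite /= ?F2; field.
Qed.

Lemma mx_a_cube : mx_a *m mx_a *m mx_a =
  (elem o2 o1 (z ^+ 3) * (elem o0 o2 (-1) * elem o1 o0 1) : SL 3 F)%g.
Proof.
apply/matrixP => k l; rewrite !elem_mulE // !elemE //.
rewrite mxE sum3 !mxE !sum3 !mxE.
by elim/ord3_ind: k; elim/ord3_ind: l; rewrite /= ?F2; field.
Qed.

Lemma mx_a_a_b : mx_a *m mx_a *m mx_b =
  SLval (elem o2 o1 (z ^+ 3) * (elem o0 o2 (-1) *
    (elem o1 o0 (-1) * elem o2 o1 (- z ^+ 3))) : SL 3 F)%g *m mx_a.
Proof.
apply/matrixP => k l.
rewrite mxE [in RHS]mxE !sum3 !elem_mulE // !elemE // !mxE !sum3 !mxE.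
by elim/ord3_ind: k; elim/ord3_ind: l; rewrite /= ?F2; field.
Qed.

End Matrices.

Local Notation inc := SL3u_in_SL3t.

Fact ra_subproof : \det (mx_a t) == 1.
Proof. by rewrite det_a // ?t_neq0 // F3t_2. Qed.
Fact rb_subproof : \det (mx_b t) == 1.
Proof. by rewrite det_b // ?t_neq0 // F3t_2. Qed.

Definition ra : SL 3 F3t := MkSL ra_subproof.
Definition rb : SL 3 F3t := MkSL rb_subproof.

Section Relations.
Local Open Scope group_scope.

Lemma inc_elem i j f : i != j -> inc (elem i j f) = elem i j (u_to_t3 f).
Proof. exact: SLmap_elem. Qed.

Lemma rb_ra : rb * ra = inc im_ba.
Proof.
rewrite /im_ba elemV // gmulfM !inc_elem // rmorphN rmorph1 u_to_t3_u.
exact/val_inj/mx_b_a/F3t_2/t_neq0.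
Qed.

Lemma ra_rb : ra * rb = inc im_ab.
Proof.
rewrite /im_ab gmulfM !inc_elem // rmorph1 u_to_t3_u.
exact/val_inj/mx_a_b/F3t_2/t_neq0.
Qed.

Lemma ra_cube : ra * ra * ra = inc im_a3.
Proof.
have -> : im_a3 = x3 * (x2^-1 * x1) by rewrite mulgA.
rewrite elemV // !gmulfM !inc_elem // rmorphN rmorph1 u_to_t3_u.
exact/val_inj/mx_a_cube/F3t_2/t_neq0.
Qed.

Lemma ra_ra_rb : ra * ra * rb = inc im_aabA * ra.
Proof.
have -> : im_aabA = x3 * (x2^-1 * (x1^-1 * x3^-1)) by rewrite !mulgA.
rewrite !elemV // !gmulfM !inc_elem // !rmorphN rmorph1 u_to_t3_u.
exact/val_inj/mx_a_a_b/F3t_2/t_neq0.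
Qed.

(** This is a b^-1 a = (a^2 b a^-1)^-1 a^3, followed by cancellation among the words in the
    [x_i]. *)
Lemma ra_rbV_ra : ra * rb^-1 * ra = inc (x3 * x1^-1).
Proof.
have -> : x3 * x1^-1 = im_aabA^-1 * im_a3.
  rewrite /im_aabA /im_a3 !invgM !invgK (cube_inv x1_cube) !mulgA mulgVK.
  by rewrite mulgK.
apply: (mulgI (inc im_aabA)); rewrite -gmulfM mulVKg -ra_cube.
by rewrite !mulgA -ra_ra_rb mulgK.
Qed.

(** For A = 1 + N with N strictly lower triangular, N^3 = 0 and characteristic 3 kills the other
    terms of the cube. *)
Lemma lower_cube (A : SL 3 F3u) :
  A o0 o0 = 1%R -> A o1 o1 = 1%R -> A o2 o2 = 1%R ->
  A o0 o1 = 0%R -> A o0 o2 = 0%R -> A o1 o2 = 0%R -> A ^+ 3 = 1.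
Proof.
move=> A00 A11 A22 A01 A02 A12; rewrite !expgS expg0 mulg1.
have E3 (x y : F3u) : x = (y *+ 3)%R -> x = 0%R by move=> ->; apply: F3u_mul3.
apply: SL_ext => k l; rewrite SL_oneE.
rewrite SL_mulE sum3 !SL_mulE !sum3.
elim/ord3_ind: k; elim/ord3_ind: l; rewrite /= ?A00 ?A11 ?A22 ?A01 ?A02 ?A12;
  try by ring.
- by apply: (E3 _ (A o1 o0)); ring.
- by apply: (E3 _ (A o2 o0 + A o2 o1 * A o1 o0)%R); ring.
- by apply: (E3 _ (A o2 o1)); ring.
Qed.

End Relations.

(** * The relations of [Gamma], the map [rho] and the image of the kernel of [mu] *)

Section Rho.
Local Open Scope group_scope.

Lemma im_baE k l : im_ba k l = ((k == l)%:R + (k == o1)%:R * (o0 == l)%:R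
   - u * (k == o2)%:R * ((o1 == l)%:R + (o0 == l)%:R))%R.
Proof.
rewrite /im_ba elemV // elem_mulE // !elemE // eqxx /= mul1r !(eq_sym l).
by rewrite -mulnb natrM; ring.
Qed.

(** The image of a b^-1 a, by [ra_rbV_ra]. *)
Let w : SL 3 F3u := x3 * x1^-1.

Lemma wE k l : w k l = ((k == l)%:R - (k == o1)%:R * (o0 == l)%:R
   + u * (k == o2)%:R * ((o1 == l)%:R - (o0 == l)%:R))%R.
Proof.
rewrite /w elemV // elem_mulE // !elemE // eqxx /= !(eq_sym l).
by rewrite -mulnb natrM; ring.
Qed.

Lemma im_ba_cube : im_ba ^+ 3 = 1.
Proof. by apply: lower_cube; rewrite im_baE /=; ring. Qed.

Lemma w_cube : w ^+ 3 = 1.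
Proof. by apply: lower_cube; rewrite wE /=; ring. Qed.

(** Both matrices are lower unitriangular, with opposite subdiagonals (1, -u) and (-1, u), so their
    commutator is trivial. *)
Lemma im_ba_w : im_ba * w = w * im_ba.
Proof.
apply: SL_ext => k l; rewrite !SL_mulE !sum3 !im_baE !wE.
by elim/ord3_ind: k; elim/ord3_ind: l; rewrite /=; ring.
Qed.

Definition rho_gens (x : gens) : SL 3 F3t := if x is gen_a then ra else rb.

Lemma rho_rels r : r \in Gamma_rels -> weval rho_gens r = 1.
Proof.
have ba : weval rho_gens [:: (gen_b, false); (gen_a, false)] = inc im_ba.
  by rewrite /weval !big_cons big_nil mulg1 /= rb_ra.
have aBa : weval rho_gens [:: (gen_a, false); (gen_b, true); (gen_a, false)] = inc w.
  by rewrite /weval !big_cons big_nil mulg1 /= mulgA ra_rbV_ra.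
rewrite !inE => /or3P[] /eqP->; rewrite ?weval_wexp ?weval_wcomm.
- by rewrite ba -gmulfXn im_ba_cube gmulf1.
- by rewrite aBa -gmulfXn w_cube gmulf1.
by rewrite ba aBa -gmulfM im_ba_w gmulfM mulgK mulgV.
Qed.

Definition rho : UMagmaMorphism.type Gamma (SL 3 F3t) := pres_lift rho_rels.

Lemma rho_a : rho Gamma_a = ra. Proof. exact: pres_lift_gen. Qed.
Lemma rho_b : rho Gamma_b = rb. Proof. exact: pres_lift_gen. Qed.

(** Sending [sigma] to [x3] detects that [sigma] has order exactly 3, since [chi] separates the
    powers of [x3]. *)
Definition order3_gens (x : unit) : SL 3 F3u := x3.

Lemma order3_rels r : r \in C3_rels -> weval order3_gens r = 1.
Proof.
rewrite inE => /eqP->; rewrite weval_wexp /weval big_cons big_nil mulg1.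
exact: x3_cube.
Qed.

Definition order3 : UMagmaMorphism.type C3 (SL 3 F3u) := pres_lift order3_rels.

Lemma order3_sigma : order3 sigma = x3. Proof. exact: pres_lift_gen. Qed.

Lemma sigma_eq1 i : (i < 3)%N -> sigma ^+ i = 1 -> i = 0%N.
Proof.
move=> lti3 /(congr1 order3); rewrite gmulfXn gmulf1 order3_sigma => xi.
have := (x3_pow i).2; rewrite xi chi1 => /esym/eqP.
by case: i lti3 {xi} => [|[|[|]]].
Qed.

(** Schreier rewriting for the transversal 1, a, a^2: a letter changes [ra ^+ i] into [ra ^+ j] up
    to a left factor from [kerchi], and [mu] follows the same exponents. Three exponents and four
    letters give twelve cases. *)
Lemma rho_step i x e : (i < 3)%N -> exists A j,
  [/\ A \in kerchi, (j < 3)%N,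
      ra ^+ i * weval rho_gens [:: (x, e)] = inc A * ra ^+ j
    & sigma ^+ i * weval mu_gens [:: (x, e)] = sigma ^+ j].
Proof.
have ex A j g c : A \in kerchi -> (j < 3)%N ->
    g = inc A * nth 1 [:: 1; ra; ra * ra] j ->
    c = nth 1 [:: 1; sigma; sigma * sigma] j ->
    exists A j, [/\ A \in kerchi, (j < 3)%N, g = inc A * ra ^+ j & c = sigma ^+ j].
  move=> KA ltj3 gA cj; exists A, j; rewrite gA cj.
  by case: j ltj3 {gA cj} => [|[|[|]]] //=; rewrite !expgS !expg0 ?mulg1.
move=> lti3.
have s3 := cube_inv sigma3.
have s_3 : sigma * sigma * sigma = 1 by rewrite -s3 mulVg.
have kV A : A \in kerchi -> A^-1 \in kerchi by move=> KA; rewrite gpredVr.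
have kM A B : A \in kerchi -> B \in kerchi -> A * B \in kerchi.
  by move=> KA KB; rewrite gpredM.
(* These identities bring products to the form of an element of [kerchi] times 1, [ra] or
   [ra * ra]. *)
have aI : ra^-1 = inc im_a3^-1 * (ra * ra).
  by apply: (mulgI (inc im_a3)); rewrite gmulfV mulVKg -ra_cube mulgK.
have bE : rb = inc (im_ba * im_a3^-1) * (ra * ra).
  by rewrite gmulfM -rb_ra -mulgA -aI mulgK.
have bI : rb^-1 = inc im_ab^-1 * ra by rewrite gmulfV -ra_rb invgM mulgVK.
have abI : ra * rb^-1 = inc im_aabA^-1 * (ra * ra).
  by apply: (mulIg rb); rewrite mulgVK -mulgA ra_ra_rb gmulfV mulKg.
have aabI : ra * ra * rb^-1 = inc (im_a3 * im_ba^-1).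
  by rewrite gmulfM gmulfV -ra_cube -rb_ra invgM !mulgA mulgK.
rewrite /weval !big_cons !big_nil !mulg1.
case: i lti3 => [|[|[|//]]] _; case: x; case: e => /=;
  rewrite ?expgS ?expg0 ?mulg1 ?mul1g.
- by apply: (ex _ 2%N _ _ (kV _ im_a3_ker)) => //=; rewrite ?aI ?s3.
- by apply: (ex _ 1%N _ _ kerchi_one) => //=; rewrite gmulf1 mul1g.
- apply: (ex _ 1%N _ _ (kV _ im_ab_ker)) => //=.
  by rewrite invgM !s3 !mulgA s_3 mul1g.
- by apply: (ex _ 2%N _ _ (kM _ _ im_ba_ker (kV _ im_a3_ker))) => //=; rewrite bE.
- by apply: (ex _ 0%N _ _ kerchi_one) => //=; rewrite ?gmulf1 mulgV ?mulg1.
- by apply: (ex _ 2%N _ _ kerchi_one) => //=; rewrite gmulf1 mul1g.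
- apply: (ex _ 2%N _ _ (kV _ im_aabA_ker)) => //=.
  by rewrite invgM !s3 !mulgA s_3 mul1g.
- apply: (ex _ 0%N _ _ im_ab_ker) => //=; first by rewrite mulg1 ra_rb.
  by rewrite mulgA s_3.
- by apply: (ex _ 1%N _ _ kerchi_one) => //=; rewrite ?gmulf1 ?mul1g mulgK.
- by apply: (ex _ 0%N _ _ im_a3_ker) => //=; rewrite mulg1 -ra_cube.
- apply: (ex _ 0%N _ _ (kM _ _ im_a3_ker (kV _ im_ba_ker))) => //=; last first.
    by rewrite mulgV.
  by rewrite mulg1 aabI.
- apply: (ex _ 1%N _ _ im_aabA_ker) => //=; first by rewrite ra_ra_rb.
  by rewrite !mulgA s_3 mul1g.
Qed.

Lemma rho_word v : exists A j,
  [/\ A \in kerchi, (j < 3)%N, weval rho_gens v = inc A * ra ^+ j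
    & weval mu_gens v = sigma ^+ j].
Proof.
elim/last_ind: v => [|v [x e] [A [i [KA lti3 rw mw]]]].
  by exists 1, 0%N; rewrite /weval !big_nil gmulf1 mul1g kerchi_one.
have [B [j [KB ltj3 rx mx]]] := rho_step x e lti3.
exists (A * B), j; rewrite -cats1 !weval_cat rw mw mx gpredM //; split=> //.
by rewrite -mulgA rx gmulfM mulgA.
Qed.

Lemma rho_Gamma0 g : g \in Gamma0 -> exists2 A, A \in kerchi & rho g = inc A.
Proof.
elim/quotW: g => v; rewrite inE => /eqP.
have [A [j [KA ltj3 rw mw]]] := rho_word v.
rewrite [mu _]pres_lift_pi mw => /(sigma_eq1 ltj3) j0.
by exists A => //; rewrite [rho _]pres_lift_pi rw j0 expg0 mulg1.
Qed.

Definition Lambda : groupClosed (SL 3 F3u) := preimg inc (imageg rho Gamma0).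

Lemma Lambda_kerchi A : A \in Lambda -> A \in kerchi.
Proof.
case/asboolP=> g /rho_Gamma0[B KB ->] /SL3u_in_SL3t_inj <-.
exact: KB.
Qed.

Lemma Lambda_image A g : mu g = 1 -> rho g = inc A -> A \in Lambda.
Proof. by move=> g1 gA; apply/asboolP; exists g; rewrite // inE g1. Qed.

(** For the inclusion of [kerchi], [kerchi_sub] asks for four elements, realised by a^3, ba, ab and
    a^2 b a^-1. *)
Lemma LambdaE : Lambda =i kerchi.
Proof.
move=> A; apply/idP/idP; first exact: Lambda_kerchi.
have s3 := cube_inv sigma3.
have s_3 : sigma * (sigma * sigma) = 1 by rewrite -s3 mulgV.
apply: kerchi_sub A; last exact: Lambda_kerchi.
- apply: (@Lambda_image _ (Gamma_a * Gamma_a * Gamma_a)).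
    by rewrite !gmulfM mu_a -mulgA s_3.
  by rewrite -ra_cube !gmulfM rho_a.
- apply: (@Lambda_image _ (Gamma_b * Gamma_a)).
    by rewrite !gmulfM mu_a mu_b expgS expg1 -mulgA s_3.
  by rewrite -rb_ra gmulfM rho_a rho_b.
- apply: (@Lambda_image _ (Gamma_a * Gamma_b)).
    by rewrite !gmulfM mu_a mu_b expgS expg1 s_3.
  by rewrite -ra_rb gmulfM rho_a rho_b.
apply: (@Lambda_image _ (Gamma_a * Gamma_a * Gamma_b * Gamma_a^-1)).
  have muV : mu Gamma_a^-1 = sigma^-1 by rewrite -mu_a; apply: gmulfV.
  by rewrite !gmulfM muV mu_a mu_b expgS expg1 -!mulgA mulgV mulg1 s_3.
have rhoV : rho Gamma_a^-1 = ra^-1 by rewrite -rho_a; apply: gmulfV.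
by rewrite -(mulgK ra (inc im_aabA)) -ra_ra_rb !gmulfM rhoV rho_a rho_b.
Qed.

End Rho.

(** * Congruence subgroups and quotients *)

Section FirstIso.
Local Open Scope quotient_scope.
Local Open Scope group_scope.
Variables (G : groupType) (H K : groupClosed G) (nKH : normal_in K H).

(** The first isomorphism theorem, with a bare operation on the target so that it also serves the
    additive group of a subspace. *)
Lemma quotg_iso (T : Type) (op : T -> T -> T) (f : subgroup H -> T) :
    {morph f : x y / x * y >-> op x y} ->
    (forall x y, cosetrel K x y <-> f x = f y) -> (forall v, exists x, f x = v) ->
  exists phi : quotg nKH -> T,
    bijective phi /\ {morph phi : x y / x * y >-> op x y}.
Proof.
move=> fM fE fS; pose phi (q : quotg nKH) := f (repr q).
have phi_pi x : phi (\pi_(quotg nKH) x) = f x by apply/fE/quotg_repr.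
have [g gK] := choice fS.
exists phi; split.
  exists (fun v => \pi_(quotg nKH) (g v)) => [q|v]; last by rewrite phi_pi gK.
  rewrite -[RHS]reprK; apply/eqP; rewrite quotg_eq; apply/fE.
  by rewrite gK.
move=> x y; elim/quotW: x => x; elim/quotW: y => y.
by rewrite [(_ * _)%g](quotg_piM nKH x y) !phi_pi.
Qed.

Lemma quotg_isog (L : groupType) (f : subgroup H -> L) :
    {morph f : x y / x * y} ->
    (forall x y, cosetrel K x y <-> f x = f y) -> (forall v, exists x, f x = v) ->
  isog (quotg nKH) L.
Proof.
move=> fM fE fS; have [phi [phiB phiM]] := quotg_iso fM fE fS.
pose F : {multiplicative quotg nKH -> L} :=
  HB.pack phi (isMultiplicative.Build _ _ phi phiM).
by exists F.
Qed.

End FirstIso.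

Lemma finite_range_factor (T U : Type) (C : finType) (F : T -> U) (c : T -> C) :
  (forall x y, c x = c y -> F x = F y) -> finite_set (range F).
Proof.
move=> cF; have [[x0 _]|T0] := pselect (exists x : T, True); last first.
  suff -> : range F = set0 by exact: finite_set0.
  by apply/seteqP; split=> [y [x _ _]|//]; case: T0; exists x.
have [g gP] : exists g : C -> T, forall x, c (g (c x)) = c x.
  have /choice[g gP] : forall v, exists x, forall y, c y = v -> c x = v.
    move=> v; have [[x xv]|nv] := pselect (exists x, c x = v); first by exists x.
    by exists x0 => y yv; case: nv; exists y.
  by exists g => x; apply: gP.
apply: (@sub_finite_set _ _ ((F \o g) @` setT)).
  by move=> _ [x _ <-]; exists (c x) => //=; apply: cF.
exact/finite_image/finite_finset.
Qed.

(** The positive exponent keeps the modulus of [in_qpoly] equal to the given power of X. *)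
Lemma in_qpoly_Xn_eq0 (R : nzRingType) n (f : {poly R}) :
  in_qpoly 'X^(n.+1) f = 0 <-> forall i, (i < n.+1)%N -> f`_i = 0.
Proof.
have vE : val (in_qpoly 'X^(n.+1) f) = Pdiv.Ring.rmodp f 'X^(n.+1).
  by rewrite /= mk_monic_Xn.
split=> [/(congr1 val)|f0].
  rewrite vE /= => /eqP; rewrite -/(Pdiv.Ring.rdvdp _ _).
  by case/(Pdiv.RingMonic.rdvdpP (monicXn _ _)) => q -> i lti; rewrite coefMXn lti.
apply/val_inj; rewrite vE -(poly_take_drop n.+1 f).
have -> : take_poly n.+1 f = 0.
  by apply/polyP => i; rewrite coef_take_poly coef0; case: ifP => // /f0.
by rewrite add0r Pdiv.RingMonic.rmodp_mull ?monicXn.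
Qed.

Lemma SLcong_coefP n (A : SL 3 F3u) :
  A \in SLcong (u ^+ n.+1) <->
  forall i j k, (k < n.+1)%N -> (A i j)`_k = ((i == j) && (k == 0%N))%:R.
Proof.
split=> [/SLcongP A1 i j k ltk|A1].
  have /in_qpoly_Xn_eq0/(_ k ltk) := A1 i j.
  by rewrite coefB coef_natb => /eqP; rewrite subr_eq0 => /eqP.
apply/SLcongP => i j; apply/in_qpoly_Xn_eq0 => k ltk.
by rewrite coefB coef_natb A1 // subrr.
Qed.

Lemma SLcong1P (A : SL 3 F3u) :
  A \in SLcong u <-> forall i j, (A i j)`_0 = (i == j)%:R.
Proof.
rewrite -[u]expr1; split=> [/SLcong_coefP A1 i j|A1]; first by rewrite A1 ?andbT.
by apply/SLcong_coefP => i j [|//] _; rewrite A1 andbT.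
Qed.

(** * First-order terms of matrices congruent to 1 mod u *)

Definition coef1_mx (A : SL 3 F3u) : 'M['F_3]_3 := \matrix_(i, j) (A i j)`_1.

Lemma SLcong2P (A : SL 3 F3u) :
  A \in SLcong (u ^+ 2) <-> A \in SLcong u /\ coef1_mx A = 0.
Proof.
split=> [A2|[/SLcong1P A1 A0]].
  split; first exact: SLcong_sub.
  by apply/matrixP => i j; move/SLcong_coefP: A2 => A2; rewrite !mxE A2 // andbF.
apply/SLcong_coefP => i j [|[|//]] _; first by rewrite A1 andbT.
by have /matrixP/(_ i j) := A0; rewrite !mxE andbF.
Qed.

(** Modulo u^2, (1 + uX)(1 + uY) is 1 + u(X + Y). *)
Lemma coef1_mxM A B : A \in SLcong u -> B \in SLcong u ->
  coef1_mx (A * B)%g = coef1_mx A + coef1_mx B.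
Proof.
move=> /SLcong1P A1 /SLcong1P B1; apply/matrixP => i j; rewrite !mxE coef_sum.
under eq_bigr => k _ do rewrite coef1M A1 B1.
rewrite big_split /= (bigD1 i) //= eqxx mul1r big1 => [|k nk]; last first.
  by rewrite eq_sym (negPf nk) mul0r.
rewrite addr0 (bigD1 j) //= eqxx mulr1 big1 => [|k nk]; last first.
  by rewrite (negPf nk) mulr0.
by rewrite addr0 addrC.
Qed.

(** Modulo u^2, det(1 + uX) is 1 + u tr X. *)
Lemma tr_coef1_mx A : A \in SLcong u -> \tr (coef1_mx A) = 0.
Proof.
move=> /SLcong1P A1; rewrite /mxtrace sum3 !mxE.
have := congr1 (fun f : F3u => f`_1) (det_SL A); rewrite det3 coef1.
rewrite !(coefD, coefN, coef1M, coef0M, A1) /= => detA.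
by apply: etrans detA; ring.
Qed.

Lemma SLcong_iwahori : {subset SLcong u <= iwahori}.
Proof. by move=> A /SLcong1P A1; apply/iwahoriP => i j _; apply: A1. Qed.

(** The constant terms drop out of [chi]; what remains is the single linear condition that cuts the
    dimension from 8 to 7. *)
Lemma SLcong_kerchi A :
  A \in SLcong u -> (A \in kerchi) = (coef1_mx A o2 o1 == 0).
Proof.
move=> A1; rewrite inE SLcong_iwahori //= /chi mxE.
by move/SLcong1P: A1 => A1; rewrite !A1 /= subrr add0r.
Qed.

Lemma SLcong2_Lambda : {subset SLcong (u ^+ 2) <= Lambda}.
Proof.
move=> A /SLcong2P[A1 A0]; rewrite LambdaE SLcong_kerchi // A0 mxE.
exact: eqxx.
Qed.

Lemma Lambda_finite_index : finite_index Lambda.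
Proof.
(* The entries mod u^2 take finitely many values and determine the coset, by [SLcong2_Lambda]. *)
pose c (A : SL 3 F3u) : 'M['F_3]_3 * 'M['F_3]_3 :=
  (\matrix_(i, j) (A i j)`_0, coef1_mx A).
apply: (finite_range_factor (c := c)) => A B [/matrixP AB0 /matrixP AB1].
have AB : SLmap (in_qpoly (u ^+ 2)) A = SLmap (in_qpoly (u ^+ 2)) B.
  apply: SL_ext => i j; rewrite !mxE; apply/eqP; rewrite -subr_eq0 -rmorphB /=.
  apply/eqP/in_qpoly_Xn_eq0 => k ltk; apply/eqP; rewrite coefB subr_eq0; apply/eqP.
  have := AB0 i j; have := AB1 i j; rewrite !mxE.
  by case: k ltk => [|[|]].
have ABL : (A^-1 * B)%g \in Lambda.
  apply: SLcong2_Lambda; rewrite inE; apply/eqP.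
  apply: (mulgI (SLmap (in_qpoly (u ^+ 2)) A)).
  by rewrite -gmulfM mulVKg mulg1 AB.
have BAL : (B^-1 * A)%g \in Lambda by rewrite -[(_ * _)%g]invgK invgM invgK gpredVr.
apply/seteqP; split=> X /= XL.
  by have := gpredM _ _ BAL XL; rewrite mulgA mulgK.
by have := gpredM _ _ ABL XL; rewrite mulgA mulgK.
Qed.

(** * The seven-dimensional subspace of trace-zero matrices *)

Definition tr_entry21 (A : 'M['F_3]_3) : 'rV['F_3]_2 :=
  \row_(j < 2) (if j == 0 then \tr A else A o2 o1).

Fact tr_entry21_linear : linear tr_entry21.
Proof.
move=> a A B; apply/rowP => j; rewrite !mxE.
by case: (j == 0); rewrite // linearP.
Qed.

HB.instance Definition _ :=
  GRing.isLinear.Build 'F_3 'M['F_3]_3 'rV['F_3]_2 _ tr_entry21 tr_entry21_linear.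

Definition sl21 : {vspace 'M['F_3]_3} := lker (linfun tr_entry21).

Lemma mem_sl21 A : (A \in sl21) = (\tr A == 0) && (A o2 o1 == 0).
Proof.
rewrite memv_ker lfunE /=; apply/eqP/andP => [/rowP A0|[/eqP A0 /eqP A1]].
  by have := A0 0; have := A0 1; rewrite !mxE /= => -> ->.
by apply/rowP => j; rewrite !mxE A0 A1 if_same.
Qed.

Lemma sl21_sub : (sl21 <= sl 'F_3 3)%VS.
Proof.
apply/subvP => A AV; rewrite mem_sl.
by move: AV; rewrite mem_sl21 => /andP[].
Qed.

(** Rank-nullity: the two linear forms are independent on a space of dimension 9. *)
Lemma dim_sl21 : \dim sl21 = 7%N.
Proof.
have := limg_ker_dim (linfun tr_entry21) fullv.
have -> : limg (linfun tr_entry21) = fullv.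
  apply/vspaceP => w; rewrite memvf; apply/memv_imgP.
  exists (w 0 0 *: delta_mx o0 o0 + w 0 1 *: delta_mx o2 o1);
    rewrite ?memvf // lfunE /=.
  apply/rowP => j; rewrite !mxE /mxtrace sum3 !mxE /=.
  case: eqP => [->|j0]; first by ring.
  rewrite mulr0 mulr1 add0r; congr (w _ _); apply/val_inj.
  by case: j j0 => [[|[|//]] ltj] // []; apply/val_inj.
by rewrite capfv !dimvf /dim /= => /(congr1 (subn^~ 2%N)); rewrite addnK.
Qed.

Local Notation Lambda_u := (capg Lambda (SLcong u)).

Lemma Lambda_uE A : (A \in Lambda_u) = (A \in SLcong u) && (coef1_mx A o2 o1 == 0).
Proof.
rewrite inE LambdaE andbC; case: (boolP (A \in SLcong u)) => //= A1.
exact: SLcong_kerchi.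
Qed.

Lemma coef1_mx_sl21 A : A \in Lambda_u -> coef1_mx A \in sl21.
Proof. by rewrite Lambda_uE mem_sl21 => /andP[A1 ->]; rewrite tr_coef1_mx ?eqxx. Qed.

Lemma SLcong_elem i j (c : 'F_3) : i != j ->
  elem i j (c *: u) \in SLcong u /\ coef1_mx (elem i j (c *: u)) = c *: delta_mx i j.
Proof.
move=> nij; split; first apply/SLcong1P => k l; last apply/matrixP => k l.
  by rewrite elemE // coefD coef_natb coef_mul_natb coef_scale_u /= andbT; ring.
rewrite !mxE elemE // coefD coef_natb coef_mul_natb coef_scale_u /= andbF.
by rewrite mulr1 add0r.
Qed.

(** Conjugating an elementary matrix by another one produces diagonal first-order terms, which
    [SLcong_elem] cannot supply. *)
Lemma SLcong_block i j (c : 'F_3) : i != j ->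
  let A := (elem i j 1 * (elem j i (c *: u) * elem i j (-1)))%g in
  A \in SLcong u /\
  coef1_mx A = c *: (delta_mx j i + delta_mx i i - delta_mx j j - delta_mx i j).
Proof.
move=> nij A; have nji : j != i by rewrite eq_sym.
have AE k l : A k l = (k == l)%:R + (c *: u) * ((k == j) && (l == i))%:R
    + (c *: u) * ((k == i) && (l == i))%:R - (c *: u) * ((k == j) && (l == j))%:R
    - (c *: u) * ((k == i) && (l == j))%:R.
  rewrite /A !elem_mulE // !elemE // ?eqxx.
  rewrite (negPf nji) /= (eq_sym i l) (eq_sym j l) (_ : true%:R = 1) //.
  by rewrite -!mulnb !natrM; ring.
split; first apply/SLcong1P => k l; last apply/matrixP => k l.
  rewrite AE !(coefD, coefN) coef_natb !coef_mul_natb !coef_scale_u /= andbT.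
  by ring.
rewrite [LHS]mxE AE !mxE !(coefD, coefN) coef_natb !coef_mul_natb !coef_scale_u /= andbF.
by rewrite !mulr1 add0r; ring.
Qed.

Lemma coef1_mx_onto (v : 'M['F_3]_3) :
  v \in sl21 -> exists2 A, A \in Lambda_u & coef1_mx A = v.
Proof.
rewrite mem_sl21 => /andP[/eqP tr0 /eqP v21].
pose im w := exists2 A, A \in SLcong u & coef1_mx A = w.
have imD w1 w2 : im w1 -> im w2 -> im (w1 + w2).
  move=> [A A1 <-] [B B1 <-]; exists (A * B)%g; first by rewrite gpredM.
  exact: coef1_mxM.
have imE i j (c : 'F_3) : i != j -> im (c *: delta_mx i j).
  by move=> nij; have [A1 AE] := SLcong_elem c nij; exists (elem i j (c *: u)).
have imB i j (c : 'F_3) : i != j ->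
    im (c *: (delta_mx j i + delta_mx i i - delta_mx j j - delta_mx i j)).
  by move=> nij; have [A1 AE] := SLcong_block c nij; eexists; [exact: A1|exact: AE].
suff [A A1 AE] : im v by exists A; rewrite // Lambda_uE A1 AE v21 eqxx.
(* The two blocks supply the diagonal, where entry (0,0) is right because the trace is 0. The other
   terms correct the off-diagonal entries except (2,1), which is 0 in [v] and in both blocks. *)
have -> : v =
    (- v o1 o1) *: (delta_mx o1 o0 + delta_mx o0 o0 - delta_mx o1 o1 - delta_mx o0 o1)
    + (- v o2 o2) *: (delta_mx o2 o0 + delta_mx o0 o0 - delta_mx o2 o2 - delta_mx o0 o2)
    + (v o0 o1 - v o1 o1) *: delta_mx o0 o1 + (v o1 o0 + v o1 o1) *: delta_mx o1 o0
    + (v o0 o2 - v o2 o2) *: delta_mx o0 o2 + (v o2 o0 + v o2 o2) *: delta_mx o2 o0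
    + v o1 o2 *: delta_mx o1 o2.
  have v00 : v o0 o0 = - v o1 o1 - v o2 o2.
    move: tr0; rewrite /mxtrace sum3 => /eqP.
    by rewrite -addrA addr_eq0 => /eqP->; ring.
  apply/matrixP => k l; rewrite !mxE.
  by elim/ord3_ind: k; elim/ord3_ind: l; rewrite /= ?v00 ?v21; ring.
do 5![apply: (imD _ _ _ (imE _ _ _ _)) => //].
by apply: imD; apply: imB.
Qed.

Lemma quotient_sl21 : exists phi : quotg (SLcong_normal Lambda) -> subvs_of sl21,
  bijective phi /\ {morph phi : x y / (x * y)%g >-> x + y}.
Proof.
have inL (x : subgroup Lambda_u) : sgval x \in SLcong u.
  by have := valP x; rewrite Lambda_uE => /andP[].
pose f (x : subgroup Lambda_u) : subvs_of sl21 :=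
  Sub (coef1_mx (sgval x)) (coef1_mx_sl21 (valP x)).
apply: (@quotg_iso _ _ _ _ _ _ f) => [x y|x y|v].
- by apply/val_inj; rewrite /= coef1_mxM.
- have xyL : ((sgval x)^-1 * sgval y)%g \in Lambda_u.
    by rewrite gpredM ?gpredVr ?(valP x) ?(valP y).
  have xyu : ((sgval x)^-1 * sgval y)%g \in SLcong u.
    by move: xyL; rewrite Lambda_uE => /andP[].
  have yE : coef1_mx (sgval y) =
      coef1_mx (sgval x) + coef1_mx ((sgval x)^-1 * sgval y)%g.
    by rewrite -coef1_mxM // mulVKg.
  split=> [/andP[_ /SLcong2P[_ xy0]]|/(congr1 val) /= xy].
    by apply/val_inj; rewrite /= yE xy0 addr0.
  apply/andP; split; first by case/andP: xyL.
  apply/SLcong2P; split=> //; apply: (addrI (coef1_mx (sgval x))).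
  by rewrite -yE addr0.
have [A AL Av] := coef1_mx_onto (valP v).
by exists (Subgroup AL); apply/val_inj.
Qed.

(* The coefficient z - x is the one that makes chi vanish. *)
Definition lift_unitri (x y z : 'F_3) : SL 3 F3u :=
  (elem o2 o1 ((z - x) *: u) *
   (elem o0 o2 z%:P * (elem o1 o2 y%:P * elem o1 o0 x%:P)))%g.

Lemma lift_unitriE x y z k l : lift_unitri x y z k l =
  (k == l)%:R + (k == o1)%:R * (x%:P * (l == o0)%:R + y%:P * (l == o2)%:R)
  + (k == o0)%:R * (z%:P * (l == o2)%:R)
  + (k == o2)%:R * ((z - x) *: u) *
      ((l == o1)%:R + x%:P * (l == o0)%:R + y%:P * (l == o2)%:R).
Proof.
rewrite /lift_unitri !elem_mulE // !elemE //= (eq_sym l) (eq_sym l) (eq_sym l).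
rewrite -!mulnb !natrM; ring.
Qed.

(** The exchange of indices sends the entries (1,0), (1,2), (0,2) of the lift to (0,1), (0,2),
    (1,2), and the leftmost factor of the lift is trivial mod u. *)
Lemma residue_lift_unitri x y z (B : SL 3 'F_3) : B \in @unitri 3 'F_3 ->
  B o0 o1 = x -> B o0 o2 = y -> B o1 o2 = z -> residue (lift_unitri x y z) = B.
Proof.
move=> /unitriP BU B01 B02 B12; apply: SL_ext => i j.
rewrite residueE lift_unitriE.
have swE : (swap01 o0 = o1) * (swap01 o1 = o0) * (swap01 o2 = o2).
  by rewrite tpermL tpermR tpermD.
elim/ord3_ind: i; elim/ord3_ind: j;
  rewrite ?B01 ?B02 ?B12 ?(BU o0 o0) ?(BU o1 o0)
    ?(BU o1 o1) ?(BU o2 o0) ?(BU o2 o1) ?(BU o2 o2) // !swE /=.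
all: rewrite !(mul0r, mulr0, addr0, add0r, mul1r, mulr1,
  coefD, coefC, coef0, coef1, coef_scale_u) //.
all: by rewrite coef0M coef_scale_u /= mulr0 mul0r ?addr0.
Qed.

Lemma chi_lift_unitri x y z : chi (lift_unitri x y z) = 0.
Proof.
rewrite /chi !lift_unitriE /=.
rewrite !(mul0r, mulr0, addr0, add0r, mul1r, mulr1) !coefC /= coef_scale_u.
by rewrite eqxx mulr1; ring.
Qed.

Lemma residue_eq1 A : residue A = 1%g <-> A \in SLcong u.
Proof.
split=> [A1|/SLcong1P A1].
  apply/SLcong1P => i j.
  have := congr1 (fun C : SL 3 'F_3 => C (swap01 i) (swap01 j)) A1.
  by rewrite /= residueE !tpermK SL_oneE (inj_eq perm_inj).
by apply: SL_ext => i j; rewrite residueE A1 (inj_eq perm_inj) SL_oneE.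
Qed.

(** The isomorphism is induced by [residue]: [residue_eq1] gives the kernel, and [lift_unitri] gives
    preimages in [kerchi]. *)
Lemma quotient_unitri :
  isog (quotg (SLcong_normal_l Lambda u)) (subgroup (@unitri 3 'F_3)).
Proof.
have inU (x : subgroup Lambda) : residue (sgval x) \in @unitri 3 'F_3.
  by have := valP x; rewrite LambdaE => /andP[].
apply: (@quotg_isog _ _ _ _ _ (fun x => Subgroup (inU x))) => [x y|x y|[B BU]].
- by apply/val_inj; apply: gmulfM.
- have xyL : ((sgval x)^-1 * sgval y)%g \in Lambda.
    by rewrite gpredM ?gpredVr ?(valP x) ?(valP y).
  have yE : residue (sgval y) =
      (residue (sgval x) * residue ((sgval x)^-1 * sgval y))%g.
    by rewrite -gmulfM mulVKg.
  split=> [/andP[_ /residue_eq1 xy1]|e].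
    by apply/val_inj/esym/(etrans yE); rewrite xy1 mulg1.
  have xy : residue (sgval x) = residue (sgval y) by apply: (congr1 val e).
  apply/andP; split=> //; apply/residue_eq1; apply: (mulgI (residue (sgval x))).
  by rewrite mulg1 -yE.
have AB := residue_lift_unitri BU erefl erefl erefl.
have AL : lift_unitri (B o0 o1) (B o0 o2) (B o1 o2) \in Lambda.
  by rewrite LambdaE inE chi_lift_unitri eqxx andbT inE AB.
by exists (Subgroup AL); apply/val_inj.
Qed.

Theorem theorem3 :
  exists rho : UMagmaMorphism.type Gamma (SL 3 F3t),
    [/\ SLval (rho Gamma_a) =
          mx_of_rows 3 [:: [:: 0;          0;          1 / t];
                           [:: 2 / t;      0;          0    ];
                           [:: 2 * t ^+ 2; 2 * t ^+ 2; 0    ]],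
        SLval (rho Gamma_b) =
          mx_of_rows 3 [:: [:: 0; 2 * t; 0         ];
                           [:: 0; 0;     2 / t ^+ 2];
                           [:: t; 0;     t         ]],
        forall M, M \in imageg rho Gamma0 -> exists A, SL3u_in_SL3t A = M
      (* rho(Gamma0), which lies in SL_3(F_3[u]) by the previous item, regarded
         as a subgroup of SL_3(F_3[u]) *)
      & let Lambda := preimg SL3u_in_SL3t (imageg rho Gamma0) in
        [/\ {subset SLcong (u ^+ 2) <= Lambda},
            finite_index Lambda,
            exists V : {vspace 'M['F_3]_3},
              [/\ (V <= sl 'F_3 3)%VS, \dim V = 7%N &
                exists phi : quotg (SLcong_normal Lambda) -> subvs_of V,
                  bijective phi /\ {morph phi : x y / (x * y)%g >-> x + y}]
          & isog (quotg (SLcong_normal_l Lambda u))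
                 (subgroup (@unitri 3 'F_3))]].
Proof.
exists rho; split; [by rewrite rho_a|by rewrite rho_b| |move=> L].
  by move=> M /asboolP[g /rho_Gamma0[A _ ->] <-]; exists A.
split; [exact: SLcong2_Lambda|exact: Lambda_finite_index| |exact: quotient_unitri].
by exists sl21; split; [exact: sl21_sub|exact: dim_sl21|exact: quotient_sl21].
Qed.
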